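(* Let $K$ be an algebraically closed field of characteristic $0$, $V,W$ $K$-vector spaces of dimensions $m,n$, and suppose $1<t<\min(m,n)$ and that $t\ne m-1$ if $m=n$. Then the singular locus of $X_t(V,W)$ consists exactly of the points $x\in X_t(V,W)$ with $\operatorname{rank}x\le1$.
   Context: $X_t(V,W)$ is the Zariski closure of the image of the map $\operatorname{Hom}_K(V,W)\to\operatorname{Hom}_K(\bigwedge^tV,\bigwedge^tW)$, $\phi\mapsto\bigwedge^t\phi$; $\operatorname{rank}x$ is the rank of $x$ as a linear map $\bigwedge^tV\to\bigwedge^tW$. *)

(* Defs.v *)
From HB Require Import structures.
From mathcomp Require Import all_boot all_algebra.
From mathcomp Require Import mpoly.

Set Implicit Arguments.
Unset Strict Implicit.
Unset Printing Implicit Defensive.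

Import GRing.Theory.
Local Open Scope ring_scope.

(* strictly increasing maps 'I_t -> 'I_n, i.e. t-subsets of {0..n-1} listed
   in increasing order; they index the standard basis e_{j_1}/\.../\e_{j_t}
   of /\^t K^n. *)
Definition incr (t n : nat) (f : {ffun 'I_t -> 'I_n}) : bool :=
  [forall a : 'I_t, forall b : 'I_t, (a < b)%N ==> (f a < f b)%N].

Definition Inc (t n : nat) := {f : {ffun 'I_t -> 'I_n} | incr f}.

Definition ext_dim (t n : nat) : nat := #|{: Inc t n}|.

(* matrix (in the standard bases) of /\^t phi : /\^t K^m -> /\^t K^n, for
   phi : K^m -> K^n given by the n x m matrix phi acting on column vectors:
   the (J, I) entry is the t x t minor of phi on rows J and columns I. *)
Definition wedge_mx (K : comNzRingType) (m n t : nat) (phi : 'M[K]_(n, m)) :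
  'M[K]_(ext_dim t n, ext_dim t m) :=
  \matrix_(i < ext_dim t n, j < ext_dim t m)
     \det (\matrix_(a < t, b < t)
             phi (val (@enum_val _ {: Inc t n} i) a)
                 (val (@enum_val _ {: Inc t m} j) b)).

Section AffineGeometry.
Variables (K : closedFieldType) (p q : nat).

Local Notation Pt := 'M[K]_(p, q).
Local Notation Poly := {mpoly K[p * q]}.

Definition ev (f : Poly) (x : Pt) : K := f.@[fun k => mxvec x 0 k].

Definition vanishes (S : Pt -> Prop) (f : Poly) : Prop :=
  forall y, S y -> ev f y = 0.

Definition zclosure (S : Pt -> Prop) : Pt -> Prop :=
  fun x => forall f, vanishes S f -> ev f x = 0.

Definition zclosed (C : Pt -> Prop) : Prop :=
  exists P : Poly -> Prop, forall x, C x <-> (forall f, P f -> ev f x = 0).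

Definition zirreducible (C : Pt -> Prop) : Prop :=
  (exists x, C x) /\
  forall C1 C2, zclosed C1 -> zclosed C2 ->
    (forall x, C x <-> (C1 x \/ C2 x)) ->
    (forall x, C x <-> C1 x) \/ (forall x, C x <-> C2 x).

Definition has_chain (X : Pt -> Prop) (d : nat) : Prop :=
  exists Z : nat -> Pt -> Prop,
    (forall i, (i <= d)%N ->
       [/\ zclosed (Z i), zirreducible (Z i) & forall x, Z i x -> X x]) /\
    (forall i, (i < d)%N ->
       (forall x, Z i x -> Z i.+1 x) /\ exists x, Z i.+1 x /\ ~ Z i x).

Definition is_dim (X : Pt -> Prop) (d : nat) : Prop :=
  has_chain X d /\ ~ has_chain X d.+1.

Definition jacobian (k : nat) (fs : 'I_k -> Poly) (x : Pt) : 'M[K]_(k, p * q) :=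
  \matrix_(i < k, j < p * q) ev (mderiv j (fs i)) x.

Definition jac_rank_is (X : Pt -> Prop) (x : Pt) (r : nat) : Prop :=
  (exists k (fs : 'I_k -> Poly),
      (forall i, vanishes X (fs i)) /\ \rank (jacobian fs x) = r) /\
  (forall k (fs : 'I_k -> Poly),
      (forall i, vanishes X (fs i)) -> (\rank (jacobian fs x) <= r)%N).

(* Jacobian criterion (Hartshorne I.5): x is a nonsingular point of X iff
   the Jacobian of I(X) at x has rank (ambient dimension) - dim X *)
Definition nonsingular (X : Pt -> Prop) (x : Pt) : Prop :=
  exists d, is_dim X d /\ jac_rank_is X x (p * q - d).

Definition singular_locus (X : Pt -> Prop) : Pt -> Prop :=
  fun x => X x /\ ~ nonsingular X x.

End AffineGeometry.

Definition Xt (K : closedFieldType) (m n t : nat) :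
  'M[K]_(ext_dim t n, ext_dim t m) -> Prop :=
  zclosure (fun x => exists phi : 'M[K]_(n, m), x = wedge_mx t phi).

(* Main.v *)
Require Import Defs.
From HB Require Import structures.
From mathcomp Require Import all_boot all_algebra perm fingroup.
From mathcomp Require Import mpoly ring zify.
From Stdlib Require Import Classical FunctionalExtensionality.

Set Implicit Arguments.
Unset Strict Implicit.
Unset Printing Implicit Defensive.

Import GRing.Theory.
Local Open Scope ring_scope.

(* On the chart where one t x t minor [x0] does not vanish, subtracting Schur complements
   shows that [Xt] is the product of an affine space, a punctured line and the cone of
   matrices of rank at most 1 of size (n - t)(m - t) x t^2: writing
   phi = P A Q + T with A the distinguished t x t block, every minor of phi is
   \det A times a polynomial in P, Q and the products T_ji (A^-1)_ba.  The vertex of the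
   cone corresponds to the points of rank 1, and the cone is singular there exactly
   because t^2 > 1 and (n - t)(m - t) > 1.  The polynomial parametrisation [psi] of these
   charts yields chains of irreducible closed sets of length n m, tangent vectors (as
   derivatives of curves contained in [Xt]) and, at the points of rank at least 2,
   enough equations of [Xt]; the upper bound n m on the length of chains comes from
   algebraic independence. *)

(** * Determinants of bordered matrices *)

Section BlockDeterminants.
Variable R : comNzRingType.

(** [Xt] is given only as a closure, without generators of its ideal, so both bounds on Jacobian
    ranks are indirect. An upper bound must hold for every family of equations and comes from
    independent tangent vectors. A lower bound needs actual equations; these are polynomial
    identities in the chart parameters, multiplied by the chosen minor so that they hold on all of
    [Xt]. The parameters d and B stand for [\det A] and A^-1 but vary freely: the formulas are
    polynomial in them, so [psi] also reaches limit points that are not exterior powers of any map.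
    On a chart T and B are not functions, only the products T_ji B_ba are. Where one product is
    nonzero, T and B are determined up to reciprocal scalars, and normalising an entry of T fixes
    these. Where all products vanish, T can be taken to be 0 while B stays arbitrary, and this
    freedom makes the tangent space too large, by at least (t^2 - 1)((n - t)(m - t) - 1). *)

Lemma det_1addM k l (U : 'M[R]_(k, l)) (V : 'M_(l, k)) :
  \det (1%:M + U *m V) = \det (1%:M + V *m U).
Proof.
(* Both products equal the matrix with blocks 1, - U, V, 1; comparing determinants gives Sylvester's
   identity. *)
have e1 : block_mx 1%:M 0 V 1%:M *m block_mx 1%:M (- U) 0 (1%:M + V *m U) =
  block_mx 1%:M (- U) V 1%:M.
  rewrite mulmx_block !mul1mx !mul0mx !mulmx1 ?mulmx0 !addr0 ?add0r.
  by rewrite mulmxN addrCA addNr addr0.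
have e2 : block_mx 1%:M (- U) 0 1%:M *m block_mx (1%:M + U *m V) 0 V 1%:M =
  block_mx 1%:M (- U) V 1%:M.
  rewrite mulmx_block !mul1mx !mul0mx !mulmx1 ?mulmx0 ?addr0 ?add0r.
  by rewrite mulNmx addrK.
have := congr1 determinant e1; rewrite -e2 !det_mulmx.
by rewrite !det_lblock !det_ublock !det1 !mul1r !mulr1 => ->.
Qed.

Lemma det_companion t (B : 'M[R]_t) : \det (block_mx 0 1%:M (- 1%:M) B) = 1.
Proof.
(* [S *m L *m S] has blocks 0, 1, - 1, 0: a rotation written through transvections, so that its
   determinant is visibly 1. *)
pose S : 'M[R]_(t + t) := block_mx 1%:M 1%:M 0 1%:M.
pose L : 'M[R]_(t + t) := block_mx 1%:M 0 (- 1%:M) 1%:M.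
have -> : block_mx 0 1%:M (- 1%:M) B =
          S *m L *m S *m block_mx 1%:M (- B) 0 1%:M :> 'M[R]_(t + t).
  rewrite /S /L !(mulmx_block, mul1mx, mul0mx, mulmx1, mulmx0, addr0, add0r).
  by rewrite !(subrr, addNr, mul0mx, mulNmx, mul1mx, mulmxN, opprK, mulmx1, addr0, add0r, oppr0).
by rewrite !det_mulmx !det_ublock !det_lblock !det1 !mulr1.
Qed.

Lemma det_mx11_block (A B C D : 'M[R]_1) :
  \det (block_mx A B C D : 'M_(1 + 1)) = A 0 0 * D 0 0 - B 0 0 * C 0 0.
Proof.
have e2 (M : 'M[R]_(1 + 1)) (i := lshift 1 0) (j := rshift 1 0) :
  \det M = M i i * M j j - M i j * M j i.
  rewrite (expand_det_row _ i) big_split_ord !big_ord1 /cofactor !det_mx11.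
  rewrite !mxE /= expr0 expr1 mul1r mulN1r mulrN.
  by congr (_ * M _ _ - _ * M _ _); apply/val_inj.
by rewrite e2 block_mxEul block_mxEur block_mxEdl block_mxEdr.
Qed.

(* The matrix is a perturbation of rank two of the one in [det_companion]. *)
Lemma det_bordered t (a b : 'I_t) (z : R) (u : 'rV[R]_t) (v : 'cV[R]_t)
    (B : 'M[R]_t) :
  \det (block_mx (z *: delta_mx a b) (1%:M + delta_mx a 0 *m u)
                 (- (1%:M + v *m delta_mx 0 b)) B) =
  (1 + u 0 a) * (1 + v b 0) + z * B b a.
Proof.
pose N0 : 'M[R]_(t + t) := block_mx 0 1%:M (- 1%:M) B.
(* The inverse of [N0]; with it [det_1addM] leaves a determinant of size 2. *)
pose N1 : 'M[R]_(t + t) := block_mx B (- 1%:M) 1%:M 0.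
pose U : 'M[R]_(t + t, 1 + 1) := block_mx (delta_mx a 0) 0 0 (- v).
pose V : 'M[R]_(1 + 1, t + t) := block_mx (z *: delta_mx 0 b) u (delta_mx 0 b) 0.
have N01 : N0 *m N1 = 1%:M.
  rewrite mulmx_block !(mul0mx, mulmx0, mul1mx, mulmx1, mulNmx, mulmxN).
  by rewrite !(opprK, addr0, add0r, addNr) -scalar_mx_block.
have -> : block_mx (z *: delta_mx a b) (1%:M + delta_mx a 0 *m u)
                 (- (1%:M + v *m delta_mx 0 b)) B = N0 *m (1%:M + (N1 *m U) *m V).
  rewrite mulmxDr mulmx1 -!mulmxA mulmxA N01 mul1mx /U /V mulmx_block.
  rewrite !mul0mx ?mulmx0 -scalemxAr mul_delta_mx !addr0 ?add0r add_block_mx.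
  by rewrite mulNmx opprD !add0r addr0.
rewrite det_mulmx det_companion mul1r det_1addM /N1 /U /V !mulmx_block.
rewrite !mul0mx ?mulmx0 !mul1mx ?addr0 ?add0r mulNmx !mulmxN mul1mx opprK.
have -> : 1%:M = block_mx 1%:M 0 0 1%:M :> 'M[R]_(1 + 1).
  by rewrite -scalar_mx_block.
rewrite add_block_mx det_mx11_block -!scalemxAl -!rowE -!colE mulmx0 !mxE.
by rewrite eqxx /=; ring.
Qed.
End BlockDeterminants.

Section BorderedMinors.
Variables (R : comNzRingType) (n m t : nat).
Implicit Types (P : 'M[R]_(n, t)) (Q : 'M[R]_(t, m)) (T : 'M[R]_(n, m)).
Implicit Types (B : 'M[R]_t) (al : 'I_t -> 'I_n) (be : 'I_t -> 'I_m).

(* For invertible [B] this is [\det B] times the (al, be)-minor of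
   [T + P *m invmx B *m Q] (lemma [bdet_schur]). *)
Definition bdet P Q T B al be : R :=
  \det (block_mx (mxsub al be T) (rowsub al P) (- colsub be Q) B).

Lemma bdet_minor T al be : bdet 0 0 T 1%:M al be = \det (mxsub al be T).
Proof.
rewrite /bdet; have -> : rowsub al (0 : 'M[R]_(n, t)) = 0.
  by apply/matrixP=> i j; rewrite !mxE.
by rewrite det_lblock det1 mulr1.
Qed.

Lemma eq_bdet P Q T B al al' be be' :
  al =1 al' -> be =1 be' -> bdet P Q T B al be = bdet P Q T B al' be'.
Proof.
move=> ea eb; congr (\det (block_mx _ _ (- _) _));
  by apply/matrixP=> i j; rewrite !mxE ?ea ?eb.
Qed.

Lemma bdet_perm P Q T B al be (s s' : 'S_t) :
  bdet P Q T B (al \o s) (be \o s') = (-1) ^+ s * (-1) ^+ s' * bdet P Q T B al be.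
Proof.
pose L : 'M[R]_(t + t) := block_mx (perm_mx s) 0 0 1%:M.
pose L' : 'M[R]_(t + t) := block_mx (perm_mx s'^-1) 0 0 1%:M.
rewrite /bdet; set A := block_mx (mxsub al be T) _ _ _.
have -> : block_mx (mxsub (al \o s) (be \o s') T) (rowsub (al \o s) P)
                 (- colsub (be \o s') Q) B = L *m A *m L'.
  rewrite /L /A /L' !mulmx_block.
  rewrite !(mul0mx, mulmx0, mul1mx, mulmx1, addr0, add0r) -!row_permE -!col_permE.
  by congr block_mx; apply/matrixP=> i j; rewrite !mxE.
rewrite !det_mulmx /L /L' !det_lblock !det1 !mulr1 !det_perm odd_permV.
by rewrite mulrAC.
Qed.

Lemma bdet_noninjl P Q T B al be : ~~ injectiveb al -> bdet P Q T B al be = 0.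
Proof.
move/injectivePn=> [i [j ij eij]].
apply: (@determinant_alternate _ _ _ (lshift t i) (lshift t j)).
  by rewrite (inj_eq (@lshift_inj _ _)).
move=> k; case: (split_ordP k) => l ->.
  by rewrite !block_mxEul !mxE eij.
by rewrite !block_mxEur !mxE eij.
Qed.

Lemma bdet_noninjr P Q T B al be : ~~ injectiveb be -> bdet P Q T B al be = 0.
Proof.
move/injectivePn=> [i [j ij eij]]; rewrite /bdet -det_tr.
apply: (@determinant_alternate _ _ _ (lshift t i) (lshift t j)).
  by rewrite (inj_eq (@lshift_inj _ _)).
move=> k; rewrite [LHS]mxE [RHS]mxE; case: (split_ordP k) => l ->.
  by rewrite !block_mxEul !mxE eij.
by rewrite !block_mxEdl !mxE eij.
Qed.

(** The upper rows are scaled by a, the lower rows by e, the left columns by b and the right columns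
    by c. This homogeneity later clears the denominators of the chart formulas. *)
Lemma bdet_scale (a b c e : R) P Q T B al be :
  bdet ((a * c) *: P) ((e * b) *: Q) ((a * b) *: T) ((e * c) *: B) al be =
  (a * b * c * e) ^+ t * bdet P Q T B al be.
Proof.
pose L : 'M[R]_(t + t) := block_mx a%:M 0 0 e%:M.
pose L' : 'M[R]_(t + t) := block_mx b%:M 0 0 c%:M.
rewrite /bdet; set A := block_mx (mxsub al be T) _ _ _; set A' := block_mx _ _ _ _.
have -> : A' = L *m A *m L'.
  rewrite /L /A /L' /A' !mulmx_block.
  rewrite !(mul0mx, mulmx0, mul1mx, mulmx1, addr0, add0r).
  rewrite !mul_mx_scalar !mul_scalar_mx !scalerA.
  by congr block_mx; apply/matrixP=> i j; rewrite !mxE; ring.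
rewrite !det_mulmx /L /L' !det_lblock !det_scalar !exprMn; ring.
Qed.

Definition upd k (f : 'I_t -> 'I_k) (a : 'I_t) (j : 'I_k) (l : 'I_t) : 'I_k :=
  if l == a then j else f l.

(** Under these normalisations the matrix is the one of [det_bordered], with u and v measuring how
    far row j of P and column i of Q are from the basis vectors that they replace. *)
Lemma bdet_special P Q T B al be (a b : 'I_t) (j : 'I_n) (i : 'I_m) :
    (forall k l, P (al k) l = (k == l)%:R) ->
    (forall k l, Q l (be k) = (l == k)%:R) ->
    (forall k i', T (al k) i' = 0) -> (forall k j', T j' (be k) = 0) ->
  bdet P Q T B (upd al a j) (upd be b i) = P j a * Q b i + T j i * B b a.
Proof.
move=> hP hQ hT1 hT2.
have := det_bordered a b (T j i) (row j P - delta_mx 0 a) (col i Q - delta_mx b 0) B.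
rewrite !mxE !eqxx ![1 + (_ - _)]addrC !subrK => <-.
rewrite /bdet; congr (\det (block_mx _ _ (- _) _)); apply/matrixP=> k l; rewrite !mxE /upd.
- case: eqP => _; last by rewrite hT1 mulr0.
  by case: eqP => _; rewrite ?hT2 ?mulr1 ?mulr0.
- rewrite big_ord1 !mxE; case: (eqVneq k a) => [->|ka].
    by rewrite eqxx mul1r eq_sym addrC subrK.
  by rewrite hP mul0r addr0.
- rewrite big_ord1 !mxE; case: (eqVneq l b) => [->|ka].
    by rewrite eqxx andbT /= mulr1 addrC subrK.
  by rewrite andbF hQ mulr0 addr0.
Qed.

Definition pair_tl (s : 'S_(t + t)) : seq ('I_t * 'I_t) :=
  pmap (fun a => if split (s (lshift t a)) is inl b then Some (a, b) else None)
       (enum 'I_t).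
Definition pair_br (s : 'S_(t + t)) : seq ('I_t * 'I_t) :=
  pmap (fun a => if split (s (rshift t a)) is inr b then Some (a, b) else None)
       (enum 'I_t).

(** The upper rows meet the permutation t times, and so do the right columns; removing the common
    top right block from both counts leaves equal numbers. *)
Lemma size_pair_tl s : size (pair_tl s) = size (pair_br s).
Proof.
rewrite /pair_tl /pair_br !size_pmap.
pose r (k : 'I_(t + t)) : bool := if split k is inr _ then true else false.
have e1 : count r (map s (enum 'I_(t + t))) = t.
  have /seq.permP -> : perm_eq (map s (enum 'I_(t + t))) (enum 'I_(t + t)).
    apply: uniq_perm; [|exact: enum_uniq|].
      by rewrite (map_inj_uniq perm_inj) enum_uniq.
    by move=> k; rewrite mem_enum -[k](permKV s) map_f ?mem_enum.
  rewrite -sum1_count big_enum_cond /= big_mkcond big_split_ord /= big1 => [|k _].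
    rewrite add0n (eq_bigr (fun=> 1%N)) ?sum1_card ?card_ord // => k _.
    by rewrite /r (unsplitK (inr _ k)).
  by rewrite /r (unsplitK (inl _ k)).
have e2 : (count (fun a => r (s (lshift t a))) (enum 'I_t) +
           count (fun a => r (s (rshift t a))) (enum 'I_t) = t)%N.
  have cE k (p : pred 'I_k) : count p (enum 'I_k) = (\sum_(i < k) p i)%N.
    rewrite -sum1_count big_enum_cond /= big_mkcond /=.
    by apply: eq_bigr => i _; case: (p i).
  by rewrite -[RHS]e1 [RHS]count_map !cE big_split_ord.
have e3 := count_predC (fun a => r (s (lshift t a))) (enum 'I_t).
rewrite size_enum_ord -[in RHS]e2 in e3.
have {e3} e3 := addnI e3.
transitivity (count (predC (fun a => r (s (lshift t a)))) (enum 'I_t)).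
  by apply: eq_count => a /=; rewrite /r; case: (split _).
by rewrite e3; apply: eq_count => a /=; rewrite /r; case: (split _).
Qed.

(* Every term of the Leibniz expansion of [bdet P Q T B] has as many factors from [T]
   as from [B]; pairing them expresses it through the products [T j i * B b a]. *)
Definition bpair P Q (M : 'I_n -> 'I_m -> 'I_t -> 'I_t -> R) al be : R :=
  \sum_(s : 'S_(t + t)) (-1) ^+ s *
    ((\prod_a (if split (s (lshift t a)) is inr l then P (al a) l else 1)) *
     (\prod_c (if split (s (rshift t c)) is inl l then - Q c (be l) else 1)) *
     \prod_(z <- zip (pair_tl s) (pair_br s))
        M (al z.1.1) (be z.1.2) z.2.1 z.2.2).

Lemma big_zip_mul (I J : Type) (r : seq I) (r' : seq J) (F : I -> R) (G : J -> R) :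
  size r = size r' ->
  \prod_(z <- zip r r') (F z.1 * G z.2) = (\prod_(i <- r) F i) * \prod_(j <- r') G j.
Proof.
elim: r r' => [|i r ih] [|j r'] //= => [_|[e]]; first by rewrite !big_nil mulr1.
by rewrite !big_cons ih //=; ring.
Qed.

Lemma bdet_pair P Q T B M al be :
    (forall j i b a, M j i b a = T j i * B b a) ->
  bdet P Q T B al be = bpair P Q M al be.
Proof.
move=> hM; rewrite /bdet /bpair; apply: eq_bigr => s _; congr (_ * _).
rewrite (eq_bigr (fun z => T (al z.1.1) (be z.1.2) * B z.2.1 z.2.2)); last first.
  by move=> z _; rewrite hM.
rewrite (@big_zip_mul _ _ _ _ (fun z => T (al z.1) (be z.2)) (fun z => B z.1 z.2));
  last exact: size_pair_tl.
rewrite big_split_ord /= mulrACA /pair_tl /pair_br !big_pmap !big_enum /=.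
rewrite -!big_split /=; apply: eq_bigr => a _.
congr (_ * _); case: split_ordP => l ->;
  by rewrite ?block_mxEul ?block_mxEur ?block_mxEdl ?block_mxEdr ?mxE ?mulr1 ?mul1r.
Qed.

End BorderedMinors.

Lemma bdet_schur (R : comUnitRingType) n m t (P : 'M[R]_(n, t)) (Q : 'M_(t, m))
    (T : 'M_(n, m)) (B : 'M_t) al be :
  B \in unitmx ->
  bdet P Q T B al be = \det B * \det (mxsub al be (T + P *m invmx B *m Q)).
Proof.
move=> uB; pose L : 'M[R]_(t + t) := block_mx 1%:M 0 (invmx B *m colsub be Q) 1%:M.
have <- : \det (block_mx (mxsub al be (T + P *m invmx B *m Q)) (rowsub al P) 0 B) =
          \det B * \det (mxsub al be (T + P *m invmx B *m Q)).
  by rewrite det_ublock mulrC.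
have <- : block_mx (mxsub al be T) (rowsub al P) (- colsub be Q) B *m L =
  block_mx (mxsub al be (T + P *m invmx B *m Q)) (rowsub al P) 0 B.
  rewrite mulmx_block !(mul0mx, mulmx0, mul1mx, mulmx1, addr0, add0r) mulKVmx //.
  rewrite addNr; congr block_mx; rewrite -mulmxA.
  apply/matrixP=> i j; rewrite !mxE; congr (_ + _).
  apply: eq_bigr => k _; rewrite !mxE; congr (_ * _).
  by apply: eq_bigr => l _; rewrite !mxE.
by rewrite det_mulmx det_lblock !det1 !mulr1.
Qed.

(** * Zariski closures and irreducibility *)

Section FunctionAlgebras.
Variables (K : closedFieldType) (Y : Type).
Implicit Types S : (Y -> K) -> Prop.

(** Abstracting the class of functions lets each construction be shown polynomial once, both along
    curves ([upoly]) and on matrix spaces ([polyfun]). *)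
Record fun_subalg S : Prop := FunSubalg {
  fs_ext : forall f g, f =1 g -> S f -> S g;
  fs_cst : forall c, S (fun=> c);
  fs_add : forall f g, S f -> S g -> S (fun y => f y + g y);
  fs_mul : forall f g, S f -> S g -> S (fun y => f y * g y) }.

Variables (S : (Y -> K) -> Prop) (hS : fun_subalg S).

Lemma fs_sum (I : Type) (r : seq I) (P : pred I) (F : I -> Y -> K) :
  (forall i, S (F i)) -> S (fun y => \sum_(i <- r | P i) F i y).
Proof.
move=> hF; elim: r => [|i r ih].
  by apply: fs_ext (fs_cst hS 0) => // y; rewrite big_nil.
case Pi : (P i); last by apply: fs_ext ih => // y; rewrite big_cons Pi.
by apply: fs_ext (fs_add hS (hF i) ih) => // y; rewrite big_cons Pi.
Qed.

Lemma fs_prod (I : Type) (r : seq I) (P : pred I) (F : I -> Y -> K) :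
  (forall i, S (F i)) -> S (fun y => \prod_(i <- r | P i) F i y).
Proof.
move=> hF; elim: r => [|i r ih].
  by apply: fs_ext (fs_cst hS 1) => // y; rewrite big_nil.
case Pi : (P i); last by apply: fs_ext ih => // y; rewrite big_cons Pi.
by apply: fs_ext (fs_mul hS (hF i) ih) => // y; rewrite big_cons Pi.
Qed.

Lemma fs_exp k f : S f -> S (fun y => f y ^+ k).
Proof.
move=> hf; elim: k => [|k ih]; first exact: fs_cst.
by apply: fs_ext (fs_mul hS hf ih) => // y; rewrite exprS.
Qed.

Lemma fs_opp f : S f -> S (fun y => - f y).
Proof.
by move=> hf; apply: fs_ext (fs_mul hS (fs_cst hS (-1)) hf) => // y; rewrite mulN1r.
Qed.

Lemma fs_sub f g : S f -> S g -> S (fun y => f y - g y).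
Proof. by move=> hf hg; apply: fs_add => //; apply: fs_opp. Qed.

Lemma fs_det k (A : Y -> 'M[K]_k) :
  (forall i j, S (fun y => A y i j)) -> S (fun y => \det (A y)).
Proof.
move=> hA; apply: fs_sum => s; apply: fs_mul => //; first exact: fs_cst.
exact: fs_prod.
Qed.

Lemma fs_bdet n m t (P : Y -> 'M[K]_(n, t)) (Q : Y -> 'M_(t, m))
    (T : Y -> 'M_(n, m)) (B : Y -> 'M_t) (al : 'I_t -> 'I_n) (be : 'I_t -> 'I_m) :
    (forall i j, S (fun y => P y i j)) -> (forall i j, S (fun y => Q y i j)) ->
    (forall i j, S (fun y => T y i j)) -> (forall i j, S (fun y => B y i j)) ->
  S (fun y => bdet (P y) (Q y) (T y) (B y) al be).
Proof.
move=> hP hQ hT hB; apply: fs_det => i j.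
case: (split_ordP i) => i' ->; case: (split_ordP j) => j' ->.
- by apply: fs_ext (hT (al i') (be j')) => // y; rewrite block_mxEul mxE.
- by apply: fs_ext (hP (al i') j') => // y; rewrite block_mxEur mxE.
- by apply: fs_ext (fs_opp (hQ i' (be j'))) => // y; rewrite block_mxEdl !mxE.
- by apply: fs_ext (hB i' j') => // y; rewrite block_mxEdr.
Qed.

Lemma fs_bpair n m t (P : Y -> 'M[K]_(n, t)) (Q : Y -> 'M_(t, m)) M
    (al : 'I_t -> 'I_n) (be : 'I_t -> 'I_m) :
    (forall i j, S (fun y => P y i j)) -> (forall i j, S (fun y => Q y i j)) ->
    (forall j i b a, S (fun y => M y j i b a)) ->
  S (fun y => bpair (P y) (Q y) (M y) al be).
Proof.
move=> hP hQ hM; apply: fs_sum => s; apply: fs_mul => //; first exact: fs_cst.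
apply: fs_mul => //; last exact: fs_prod.
apply: fs_mul => //; apply: fs_prod => a; case: (split _) => l //; try exact: fs_cst.
exact: fs_opp.
Qed.

Lemma fs_ev p q (f : {mpoly K[p * q]}) (c : Y -> 'M[K]_(p, q)) :
  (forall i j, S (fun y => c y i j)) -> S (fun y => ev f (c y)).
Proof.
move=> hc; apply: fs_sum => mm; apply: fs_mul => //; first exact: fs_cst.
apply: fs_prod => k; apply: fs_exp; case/mxvec_indexP: k => i j.
by apply: fs_ext (hc i j) => // y; rewrite mxvecE.
Qed.

End FunctionAlgebras.

Section PolynomialFunctions.
Variable K : closedFieldType.

Definition upoly (F : K -> K) := exists P : {poly K}, forall a, P.[a] = F a.

Definition polyfun p q (F : 'M[K]_(p, q) -> K) :=
  exists f : {mpoly K[p * q]}, forall y, ev f y = F y.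

Lemma upoly_subalg : fun_subalg upoly.
Proof.
split=> [f g e [P hP]|c|f g [P hP] [Q hQ]|f g [P hP] [Q hQ]].
- by exists P => a; rewrite hP e.
- by exists c%:P => a; rewrite hornerC.
- by exists (P + Q) => a; rewrite hornerD hP hQ.
- by exists (P * Q) => a; rewrite hornerM hP hQ.
Qed.

Lemma upolyX : upoly id.
Proof. by exists 'X => a; rewrite hornerX. Qed.

Lemma polyfun_subalg p q : fun_subalg (@polyfun p q).
Proof.
split=> [f g e [P hP]|c|f g [P hP] [Q hQ]|f g [P hP] [Q hQ]].
- by exists P => a; rewrite hP e.
- by exists c%:MP => a; rewrite /ev mevalC.
- by exists (P + Q) => a; rewrite -hP -hQ /ev mevalD.
- by exists (P * Q) => a; rewrite -hP -hQ /ev mevalM.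
Qed.

Lemma polyfun_coord p q i j : polyfun (fun y : 'M[K]_(p, q) => y i j).
Proof. by exists 'X_(mxvec_index i j) => y; rewrite /ev mevalXU mxvecE. Qed.

Lemma horner_inj (P Q : {poly K}) : (forall a, P.[a] = Q.[a]) -> P = Q.
Proof.
move=> e; apply/eqP; rewrite -subr_eq0; apply/negPn/negP => /closed_nonrootP [a].
by rewrite /root hornerD hornerN e subrr eqxx.
Qed.

End PolynomialFunctions.

Section Closures.
Variables (K : closedFieldType) (p q : nat).
Local Notation Pt := 'M[K]_(p, q).
Local Notation Poly := {mpoly K[p * q]}.
Implicit Types (Z X : Pt -> Prop) (f g : Poly).

Definition polycurve (c : K -> Pt) := forall i j, upoly (fun a => c a i j).

Lemma sub_zclosure X x : X x -> zclosure X x.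
Proof. by move=> Xx f; apply. Qed.

Lemma vanishes_zclosure X f : vanishes X f -> vanishes (zclosure X) f.
Proof. by move=> hf y; apply. Qed.

Lemma zclosed_zclosure X : zclosed (zclosure X).
Proof. by exists (vanishes X) => x. Qed.

Lemma zclosure_min X Z : zclosed Z -> (forall x, X x -> Z x) ->
  forall x, zclosure X x -> Z x.
Proof. by move=> [P hP] XZ x Xx; apply/hP => f Pf; apply: Xx => y /XZ /hP; apply. Qed.

Lemma zclosedPn Z x : zclosed Z -> ~ Z x -> exists2 f, vanishes Z f & ev f x <> 0.
Proof.
move=> [P hP] nZ; apply: NNPP => nf; apply: nZ; apply/hP => f Pf.
apply: NNPP => fx; apply: nf; exists f => // y /hP; exact.
Qed.

(** If two closed sets cover the closure and neither contains X, equations detecting this restrict,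
    along a curve joining two suitable points, to nonzero univariate polynomials with product
    zero. *)
Lemma zirreducible_curves X :
    (exists x, X x) ->
    (forall y z, X y -> X z ->
      exists c, [/\ polycurve c, c 0 = y, c 1 = z & forall a, X (c a)]) ->
  zirreducible (zclosure X).
Proof.
move=> [x0 X0] hX; split; first by exists x0; apply: sub_zclosure.
move=> C1 C2 cl1 cl2 hC.
case: (classic (forall x, X x -> C1 x)) => [X1|n1].
  by left=> x; split=> [|C1x]; [apply: zclosure_min | apply/hC; left].
case: (classic (forall x, X x -> C2 x)) => [X2|n2].
  by right=> x; split=> [|C2x]; [apply: zclosure_min | apply/hC; right].
have [y ny] := not_all_ex_not _ _ n1; have [Xy nC1] := imply_to_and _ _ ny.
have [z nz] := not_all_ex_not _ _ n2; have [Xz nC2] := imply_to_and _ _ nz.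
have [f fC fy] := zclosedPn cl1 nC1; have [g gC gz] := zclosedPn cl2 nC2.
have [c [pc c0 c1 Xc]] := hX _ _ Xy Xz.
have [P hP] := fs_ev (upoly_subalg K) f pc.
have [Q hQ] := fs_ev (upoly_subalg K) g pc.
have /eqP : P * Q = 0.
  apply: horner_inj => a; rewrite hornerM hP hQ horner0.
  have /hC [/fC ->|/gC ->] : zclosure X (c a) by apply: sub_zclosure.
    by rewrite mul0r.
  by rewrite mulr0.
rewrite mulf_eq0 => /orP [] /eqP e.
  by case: fy; rewrite -c0 -hP e horner0.
by case: gz; rewrite -c1 -hQ e horner0.
Qed.

Lemma zclosedI1 Z f : zclosed Z -> zclosed (fun x => Z x /\ ev f x = 0).
Proof.
move=> [P hP]; exists (fun g => P g \/ g = f) => x; split.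
  by move=> [/hP Zx fx] g [|->//]; apply: Zx.
by move=> h; split; [apply/hP => g Pg; apply: h; left | apply: h; right].
Qed.

Lemma zirreducible_mul Z f g : zclosed Z -> zirreducible Z ->
  vanishes Z (f * g) -> vanishes Z f \/ vanishes Z g.
Proof.
move=> cZ [_ iZ] fg.
case: (iZ _ _ (zclosedI1 f cZ) (zclosedI1 g cZ)) => [x|h|h].
- split=> [Zx|[[]|[]]//]; have := fg _ Zx; rewrite /ev mevalM => /eqP.
  by rewrite mulf_eq0 => /orP [] /eqP; [left | right].
- by left=> y /h [].
- by right=> y /h [].
Qed.

Lemma zirreducible_exp Z f k : zclosed Z -> zirreducible Z ->
  vanishes Z (f ^+ k) -> vanishes Z f.
Proof.
move=> cZ iZ; elim: k => [|k ih].
  move=> h; have [[x Zx] _] := iZ; have := h _ Zx.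
  by rewrite expr0 /ev meval1 => /eqP; rewrite oner_eq0.
by rewrite exprS => /(zirreducible_mul cZ iZ) [|/ih].
Qed.

End Closures.

(** * Dimension and tangent vectors *)

Section AlgebraicIndependence.
Variable K : closedFieldType.

(** Exponent vectors with entries below s, nested as pairs so that the last exponent can be split
    off in the induction of [chain_independent]. *)
Fixpoint exps (s k : nat) : finType :=
  if k is k'.+1 then (exps s k' * 'I_s)%type else unit.

Lemma card_exps s k : #|exps s k| = (s ^ k)%N.
Proof. by elim: k => [|k ih]; rewrite ?card_unit //= card_prod ih card_ord expnSr. Qed.

Fixpoint monom (M : nat) (f : nat -> {mpoly K[M]}) s k : exps s k -> {mpoly K[M]} :=
  match k with
  | 0 => fun _ => 1
  | k'.+1 => fun a => @monom M f s k' a.1 * f k' ^+ a.2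
  end.

Lemma msize_exp_le M (f : {mpoly K[M]}) E k :
  (msize f <= E)%N -> (msize (f ^+ k) <= 1 + k * E.+1)%N.
Proof.
move=> hf; elim: k => [|k ih]; first by rewrite expr0 msize1.
rewrite exprS mulSn addnCA addSn; apply: leq_trans (msizeM_le _ _) _.
by rewrite ltnS leq_add.
Qed.

(** The bound is crude; what the count in [no_chain] uses is its linear growth in s. *)
Lemma msize_monom M (f : nat -> {mpoly K[M]}) s k E (a : exps s k) :
  (forall i, i < k -> msize (f i) <= E)%N -> (msize (monom f a) <= 1 + k * (s * E.+1).+2)%N.
Proof.
elim: k a => [|k ih] a hf /=; first by rewrite msize1.
apply: leq_trans (msizeM_le _ _) _.
have h1 := ih a.1 (fun i ik => hf i (ltnW ik)).
have h2 : (msize (f k ^+ a.2) <= 1 + s * E.+1)%N.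
  apply: leq_trans (msize_exp_le _ (hf k (ltnSn k))) _.
  by rewrite leq_add2l leq_mul2r ltnW ?orbT.
apply: (@leq_trans ((1 + k * (s * E.+1).+2) + (1 + s * E.+1)).+1).
  by rewrite ltnS leq_add.
by rewrite mulSn; move: (s * _)%N (k * _)%N => u v; lia.
Qed.

Lemma leq_mnm_mdeg M (m : 'X_{1..M}) i : (m i <= mdeg m)%N.
Proof. by rewrite mdegE (bigD1 i) //= leq_addr. Qed.

(** There are at most b ^ M monomials of degree below b, so the matrix of coefficients has more rows
    than columns. *)
Lemma mpoly_dependent M b (I : finType) (g : I -> {mpoly K[M]}) :
    (forall i, msize (g i) <= b)%N -> (b ^ M < #|I|)%N ->
  exists2 c : I -> K, exists i, c i != 0 & \sum_i c i *: g i = 0.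
Proof.
move=> gb Ib; pose J : finType := 'X_{1..M < b}.
have cJ : (#|J| <= b ^ M)%N.
  pose h (m : J) : {ffun 'I_M -> 'I_b} :=
    [ffun i => Ordinal (leq_ltn_trans (leq_mnm_mdeg (bmnm m) i) (bmdeg m))].
  have /leq_card : injective h.
    move=> m1 m2 e; apply/val_inj/mnmP => i.
    by move/ffunP: e => /(_ i); rewrite !ffunE => /(congr1 val).
  by rewrite card_ffun !card_ord.
pose A := \matrix_(i < #|I|, j < #|J|) (g (enum_val i))@_(bmnm (enum_val j)).
have : kermx A != 0.
  rewrite kermx_eq0 /row_free; apply/negP => /eqP rA.
  by have := rank_leq_col A; rewrite rA leqNgt (leq_ltn_trans cJ Ib).
move=> /rowV0Pn [u /sub_kermxP uA u0].
exists (fun i => u 0 (enum_rank i)).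
  move/rV0Pn: u0 => [k uk]; exists (enum_val k).
  by rewrite enum_valK.
apply/mpolyP => mm; rewrite mcoeff0 raddf_sum /=.
case: (ltnP (mdeg mm) b) => hm.
  have := congr1 (fun B : 'rV_ _ => B 0 (enum_rank (BMultinom hm))) uA.
  rewrite !mxE => e0; rewrite -[RHS]e0 (reindex _ (onW_bij _ (@enum_val_bij I))) /=.
  by apply: eq_bigr => i _; rewrite mcoeffZ mxE enum_valK enum_rankK.
apply: big1 => i _; rewrite mcoeffZ memN_msupp_eq0 ?mulr0 //.
by apply: msize_mdeg_ge; apply: leq_trans (gb i) hm.
Qed.

Section Chains.
Variables p q : nat.
Local Notation Pt := 'M[K]_(p, q).
Local Notation Poly := {mpoly K[p * q]}.
Variables (Z : nat -> Pt -> Prop) (f : nat -> Poly).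

(** Take a relation on the largest set and factor out the lowest power of the last function. The
    ideal is prime and does not contain that function, so the cofactor vanishes there too. On the
    previous set the last function is zero, which leaves a relation between the lowest coefficients
    alone, and induction applies. *)
Lemma chain_independent s D :
    (forall i, (i <= D)%N -> zclosed (Z i) /\ zirreducible (Z i)) ->
    (forall i, (i < D)%N -> [/\ forall x, Z i x -> Z i.+1 x,
       vanishes (Z i) (f i) & ~ vanishes (Z i.+1) (f i)]) ->
  forall c : exps s D -> K, vanishes (Z D) (\sum_a c a *: monom f a) ->
  forall a, c a = 0.
Proof.
elim: D => [|D ih] hZ hf c hc.
  move=> []; have [_ [[x Zx] _]] := hZ 0 (leqnn _).
  have := hc x Zx; rewrite (big_pred1 tt) => [|[]//].
  by rewrite /ev mevalZ meval1 mulr1.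
have [cZ iZ] := hZ _ (leqnn D.+1); have [sZ f0 f1] := hf D (ltnSn D).
suff h k : forall (ks : (k < s)%N) a, c (a, Ordinal ks) = 0.
  by move=> [a [k ks]]; apply: h.
elim/ltn_ind: k => k ihk ks.
pose g := \sum_(j : 'I_s | (k <= j)%N) \sum_(a : exps s D)
   c (a, j) *: (monom f a * f D ^+ (j - k)).
have e : \sum_a c a *: @monom _ f s D.+1 a = f D ^+ k * g.
  transitivity (\sum_(a : exps s D) \sum_(j : 'I_s) c (a, j) *: (monom f a * f D ^+ j)).
    by rewrite pair_bigA; apply: eq_bigr => [] [].
  rewrite exchange_big /= (bigID (fun j : 'I_s => (k <= j)%N)) /= addrC big1 => [|j].
    rewrite add0r mulr_sumr; apply: eq_bigr => j kj; rewrite mulr_sumr.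
    apply: eq_bigr => a _; rewrite -scalerAr mulrCA -exprD subnKC //.
  rewrite -ltnNge => jk; apply: big1 => a _.
  by rewrite [j](_ : j = Ordinal (ltn_ord j)) ?ihk ?scale0r //; apply/val_inj.
have [fk|gZ] : vanishes (Z D.+1) (f D ^+ k) \/ vanishes (Z D.+1) g.
- by apply: zirreducible_mul => //; rewrite -e.
- by case: f1; apply: zirreducible_exp fk.
apply: (ih _ _ (fun a => c (a, Ordinal ks))) => [i iD|i iD|y Zy].
- by apply: hZ; apply: leqW.
- by apply: hf; apply: leqW.
have := gZ _ (sZ _ Zy); rewrite /g (bigD1 (Ordinal ks)) //= /ev mevalD.
rewrite subnn [X in _ + X](_ : _ = 0) ?addr0 => [<-|].
  by congr (_.@[_]); apply: eq_bigr => a _; rewrite expr0 mulr1.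
rewrite raddf_sum big1 // => j /andP [kj jk]; rewrite raddf_sum big1 // => a _.
rewrite /= mevalZ mevalM rmorphXn /= -/(ev (f D) y) f0 // expr0n.
rewrite subn_eq0 leqNgt ltn_neqAle kj andbT eq_sym.
by rewrite -val_eqE /= in jk; rewrite jk /= mulr0 mulr0.
Qed.
End Chains.

Lemma finite_choice (T : Type) (x0 : T) D (P : nat -> T -> Prop) :
  (forall i, (i < D)%N -> exists x, P i x) ->
  exists f, forall i, (i < D)%N -> P i (f i).
Proof.
elim: D => [|D ih] h; first by exists (fun=> x0).
have [i iD|f hf] := ih; first by apply: h; apply: leqW.
have [x Px] := h D (ltnSn D).
exists (fun i => if i == D then x else f i) => i; rewrite ltnS leq_eqVlt.
by case: eqP => [-> //|_ /=]; apply: hf.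
Qed.

Lemma monom_ev M M' (F : {mpoly K[M]} -> K) (F' : {mpoly K[M']} -> K) :
    (forall f g, F (f * g) = F f * F g) -> (forall f g, F' (f * g) = F' f * F' g) ->
    F 1 = 1 -> F' 1 = 1 ->
  forall f f' s D (a : exps s D), (forall i, (i < D)%N -> F (f i) = F' (f' i)) ->
  F (monom f a) = F' (monom f' a).
Proof.
move=> FM FM' F1 F1' f f' s; elim=> [|D ih] a hf /=; first by rewrite F1 F1'.
rewrite FM FM' ih => [|i iD]; last by apply: hf; apply: leqW.
congr (_ * _); elim: (nat_of_ord a.2) => [|k ihk]; first by rewrite !expr0 F1 F1'.
by rewrite !exprS FM FM' ihk hf.
Qed.

(* A chain of length [D] yields [D] functions algebraically independent on the image,
   whereas [n * m + 1] polynomials in [n * m] variables are dependent: for [s] large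
   there are more monomials with exponents below [s] than room for their values. *)
Lemma no_chain p q n m (Phi : 'M[K]_(n, m) -> 'M[K]_(p, q)) :
    (forall i j, polyfun (fun w => Phi w i j)) ->
  ~ has_chain (zclosure (fun x => exists w, x = Phi w)) (n * m).+1.
Proof.
move=> pPhi [Z [hZ sZ]]; set D := (n * m).+1 in hZ sZ.
have [f hf] : exists f, forall i, (i < D)%N ->
    vanishes (Z i) (f i) /\ ~ vanishes (Z i.+1) (f i).
  apply: (@finite_choice {mpoly K[p * q]} 0 D
    (fun i f => vanishes (Z i) f /\ ~ vanishes (Z i.+1) f)) => i iD.
  have [_ [x [Zx nZx]]] := sZ i iD; have [cZ _ _] := hZ i (ltnW iD).
  have [g gZ gx] := zclosedPn cZ nZx.
  by exists g; split => // /(_ x Zx).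
have [h hh] : exists h : nat -> {mpoly K[n * m]}, forall i, (i < D)%N ->
    forall w, ev (h i) w = ev (f i) (Phi w).
  apply: (@finite_choice {mpoly K[n * m]} 0 D
    (fun i g => forall w, ev g w = ev (f i) (Phi w))) => i iD.
  exact: (fs_ev (polyfun_subalg K n m) (f i) pPhi).
(* All s ^ D monomials have size at most C * s. As D = n * m + 1, dependence follows once (C * s) ^
   (n * m) < s ^ D, that is C ^ (n * m) < s. *)
pose E := (\max_(i < D) msize (h i))%N.
pose C := (1 + D * E.+1.+2)%N; pose s := (C ^ (n * m)).+1.
have bd (a : exps s D) : (msize (monom h a) <= C * s)%N.
  have hE i : (i < D)%N -> (msize (h i) <= E)%N.
    by move=> iD; apply: (leq_bigmax (Ordinal iD)).
  apply: leq_trans (msize_monom a hE) _.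
  have s0 : (0 < s)%N by [].
  rewrite /C mulnDl mul1n leq_add // -mulnA leq_mul // mulnC -addn3 mulnDl.
  by rewrite -addn2 -[E.+1]addn1 mulnDl mul1n; lia.
have [|c [a ca] c0] := mpoly_dependent bd.
  by rewrite card_exps expnMn /D expnSr mulnC ltn_mul2l expn_gt0 /= ltnSn.
case/eqP: ca; apply: (@chain_independent _ _ Z f) => [i iD|i iD|].
- by have [? ? _] := hZ i iD.
- by have [? _] := sZ i iD; have [? ?] := hf i iD.
have [_ _ ZX] := hZ D (leqnn D).
move=> y /ZX; apply=> _ [w ->].
have := congr1 (fun g => ev g w) c0; rewrite /ev !raddf_sum meval0 /= => e0.
rewrite -[RHS]e0; apply: eq_bigr => b _; rewrite !mevalZ; congr (_ * _).
have := @monom_ev _ _ (fun g => ev g (Phi w)) (fun g => ev g w) _ _ _ _ f h s D b.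
apply=> [g g'|g g'|||i iD]; by rewrite /ev ?mevalM ?meval1 // -/(ev _ _) -hh.
Qed.

End AlgebraicIndependence.

(** * Tangent vectors as velocities of polynomial curves *)

Section Tangents.
Variables (K : closedFieldType) (p q : nat).
Local Notation Pt := 'M[K]_(p, q).
Local Notation Poly := {mpoly K[p * q]}.

Definition tangent (X : Pt -> Prop) (x y : Pt) :=
  forall f, vanishes X f -> \sum_k ev (mderiv k f) x * mxvec y 0 k = 0.

(** The chain rule, checked on constants and variables and carried through sums and products. *)
Lemma deriv_mmap N (v : 'I_N -> {poly K}) (f : {mpoly K[N]}) :
  (mmap (@polyC K) v f)^`() =
  \sum_k mmap (@polyC K) v (mderiv k f) * (v k)^`().
Proof.
pose good (f : {mpoly K[N]}) := (mmap (@polyC K) v f)^`() =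
  \sum_k mmap (@polyC K) v (mderiv k f) * (v k)^`().
have goodD g h : good g -> good h -> good (g + h).
  rewrite /good rmorphD derivD => -> ->; rewrite -big_split /=.
  by apply: eq_bigr => k _; rewrite mderivD rmorphD mulrDl.
have goodM g h : good g -> good h -> good (g * h).
  rewrite /good rmorphM derivM => -> ->; rewrite mulr_suml mulr_sumr -big_split /=.
  by apply: eq_bigr => k _; rewrite mderivM rmorphD !rmorphM /=; ring.
have goodC c : good c%:MP.
  rewrite /good mmapC derivC big1 // => k _.
  by rewrite mderivC rmorph0 mul0r.
have goodX i : good 'X_i.
  rewrite /good mmapX mmap1U (bigD1 i) //= big1 ?addr0 => [|k ki].
    have -> : mderiv i 'X_i = 1 :> {mpoly K[N]}.
      rewrite mderivX mnm1E eqxx scale1r (_ : (U_(i) - U_(i))%MM = 0%MM) ?mpolyX0 //.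
      by apply/mnmP => j; rewrite mnmBE subnn mnm0E.
    by rewrite rmorph1 mul1r.
  by rewrite mderivX mnm1E eq_sym (negPf ki) scale0r rmorph0 mul0r.
have goodXm mm : good 'X_[mm].
  rewrite mpolyXE_id; elim/big_rec: _ => [|i g _ gg]; first exact: goodC.
  apply: (goodM) => //; elim: (mm i) => [|k ih]; first exact: goodC.
  by rewrite exprS; apply: goodM.
elim/mpolyind: f => [|c mm g _ _ hg]; first exact: goodC.
by apply: goodD => //; rewrite -mul_mpolyC; apply: goodM.
Qed.

Lemma horner_mmap N (v : 'I_N -> {poly K}) (f : {mpoly K[N]}) a :
  (mmap (@polyC K) v f).[a] = f.@[fun k => (v k).[a]].
Proof.
rewrite mevalE /mmap horner_sum; apply: eq_bigr => mm _.
rewrite hornerM hornerC /mmap1 horner_prod; congr (_ * _).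
by apply: eq_bigr => k _; rewrite horner_exp.
Qed.

Lemma polycurve_mx (c : K -> Pt) : polycurve c ->
  exists g : 'M[{poly K}]_(p, q), forall a i j, (g i j).[a] = c a i j.
Proof.
move=> hc; pose P (k : nat) (g : {poly K}) :=
  forall i j, k = mxvec_index i j -> forall a, g.[a] = c a i j.
have [k kpq|g hg] := @finite_choice {poly K} 0 (p * q) P.
  case/mxvec_indexP: (Ordinal kpq) (erefl k : k = Ordinal kpq) => i j -> //.
  have [g hg] := hc i j; exists g => i' j' /val_inj /= e a; rewrite hg.
  by have := congr1 (fun l => mxvec (c a) 0 l) e; rewrite !mxvecE.
exists (\matrix_(i, j) g (mxvec_index i j)) => a i j.
by rewrite mxE (hg _ _ i j).
Qed.

Lemma ev_deriv_curve (g : 'M[{poly K}]_(p, q)) (c : K -> Pt) (f : Poly) (P : {poly K}) :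
    (forall a i j, (g i j).[a] = c a i j) -> (forall a, P.[a] = ev f (c a)) ->
  \sum_k ev (mderiv k f) (c 0) * mxvec (map_mx (fun u => u^`().[0]) g) 0 k = P^`().[0].
Proof.
move=> hg hP; pose v (k : 'I_(p * q)) := mxvec g 0 k.
have hv a f' : (mmap (@polyC K) v f').[a] = ev f' (c a).
  rewrite horner_mmap; apply: meval_eq => k; rewrite /v.
  by case/mxvec_indexP: k => i j; rewrite !mxvecE.
have -> : P = mmap (@polyC K) v f by apply: horner_inj => a; rewrite hv hP.
rewrite deriv_mmap horner_sum; apply: eq_bigr => k _.
rewrite hornerM hv; congr (_ * _); rewrite /v.
by case/mxvec_indexP: k => i j; rewrite !mxvecE mxE.
Qed.

Lemma ev_mderiv (f : Poly) (x : Pt) i j (A B : K) :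
    (forall a, ev f (x + a *: delta_mx i j) = A + a * B) ->
  ev (mderiv (mxvec_index i j) f) x = B.
Proof.
move=> h; pose c a := x + a *: delta_mx i j.
pose g : 'M[{poly K}]_(p, q) := \matrix_(k, l) ((x k l)%:P + (delta_mx i j k l)%:P * 'X).
have hg a k l : (g k l).[a] = c a k l.
  by rewrite /c !mxE hornerD hornerM !hornerC hornerX mulrC.
have := @ev_deriv_curve g c f (A%:P + B%:P * 'X) hg.
rewrite derivD derivM !derivC derivX mul0r !add0r mulr1 hornerC => <-; last first.
  by move=> a; rewrite hornerD hornerM !hornerC hornerX h mulrC.
rewrite /c scale0r addr0 (bigD1 (mxvec_index i j)) //= big1 ?addr0 => [|k].
  by rewrite mxvecE !mxE derivD derivM !derivC derivX mul0r !add0r mulr1 hornerC !eqxx mulr1.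
case/mxvec_indexP: k => k l ne; rewrite mxvecE !mxE derivD derivM !derivC derivX.
rewrite mul0r !add0r mulr1 hornerC (_ : (k == i) && (l == j) = false) ?mulr0 //.
by apply: contraNF ne => /andP [/eqP -> /eqP ->].
Qed.

(** Here y is the velocity of the curve at 0. The second clause evaluates linear forms on y by
    differentiation, in the format supplied by [lin_sum]. *)
Lemma curve_tangent (X : Pt -> Prop) (c : K -> Pt) :
    polycurve c -> (forall a, X (c a)) ->
  exists2 y, tangent X (c 0) y &
    forall (I : finType) (u : I -> K) (s : I -> 'I_p) (r : I -> 'I_q) (P : {poly K}),
      (forall a, \sum_i u i * c a (s i) (r i) = P.[a]) ->
      \sum_i u i * y (s i) (r i) = P^`().[0].
Proof.
move=> /polycurve_mx [g hg] Xc; exists (map_mx (fun u => u^`().[0]) g).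
  move=> f fX; have := @ev_deriv_curve g c f 0 hg.
  by rewrite deriv0 horner0; apply=> a; rewrite horner0 fX.
move=> I u s r P h.
have <- : \sum_i (u i)%:P * g (s i) (r i) = P.
  apply: horner_inj => a; rewrite horner_sum -h.
  by apply: eq_bigr => i _; rewrite hornerM hornerC hg.
rewrite raddf_sum horner_sum /=.
by apply: eq_bigr => i _; rewrite derivM derivC mul0r add0r hornerM hornerC mxE.
Qed.

(** Ordered by weight, the matrix of values l s' (y s) is triangular with nonzero diagonal, so the y
    s are independent; all of them are killed by the Jacobian. *)
Lemma rank_tangents (X : Pt -> Prop) (x : Pt) (S : finType)
    (l : S -> Pt -> K) (W : S -> nat) :
    (forall s a u v, l s (a *: u + v) = a * l s u + l s v) ->
    (forall s, exists y, [/\ tangent X x y, l s y != 0 &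
       forall s', s != s' -> (W s' <= W s)%N -> l s' y = 0]) ->
  forall k (fs : 'I_k -> Poly), (forall i, vanishes X (fs i)) ->
    (\rank (jacobian fs x) + #|S| <= p * q)%N.
Proof.
move=> lin /fin_all_exists [y hy] k fs hfs.
have tY s : tangent X x (y s) by case: (hy s).
have diag s : l s (y s) != 0 by case: (hy s).
have tri s s' : s != s' -> (W s' <= W s)%N -> l s' (y s) = 0.
  by case: (hy s) => _ _; apply.
have l0 s : l s 0 = 0.
  have := lin s 1 0 0; rewrite scale1r addr0 mul1r => /eqP.
  by rewrite -subr_eq subrr eq_sym => /eqP.
pose Y := \matrix_(i < #|S|) mxvec (y (enum_val i)).
have fY : \rank Y = #|S|.
  apply/eqP/row_freeP; apply/row_freeP; rewrite -kermx_eq0; apply/negPn/negP.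
  move=> /rowV0Pn [u /sub_kermxP uY]; apply/negP; rewrite negbK.
  have e : \sum_s u 0 (enum_rank s) *: y s = 0.
    apply: (can_inj (@mxvecK _ _ _)); rewrite linear0 -uY mulmx_sum_row linear_sum.
    rewrite (reindex _ (onW_bij _ (@enum_val_bij S))) /=.
    by apply: eq_bigr => i _; rewrite linearZ /= rowK enum_valK.
  have ls s : \sum_s' u 0 (enum_rank s') * l s (y s') = 0.
    rewrite -[RHS](l0 s) -e; elim/big_rec2: _ => [|i v w _ ->]; first by rewrite l0.
    by rewrite lin.
  suff h w s : (W s < w)%N -> u 0 (enum_rank s) = 0.
    apply/eqP/rowP => i; rewrite [RHS]mxE -[i]enum_valK. by rewrite (h _ _ (ltnSn _)).
  elim: w s => // w ih s ws; have := ls s; rewrite (bigD1 s) //= big1 ?addr0.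
    by move/eqP; rewrite mulf_eq0 (negPf (diag s)) orbF => /eqP.
  move=> s' ne; case: (ltnP (W s') (W s)) => ws'; last by rewrite tri ?mulr0.
  by rewrite ih ?mul0r //; apply: leq_trans ws' _.
rewrite -[X in (_ + X)%N]fY -(mxrank_tr Y); apply: mulmx0_rank_max.
apply/matrixP => i j; rewrite !mxE -[RHS](tY (enum_val j) _ (hfs i)).
by apply: eq_bigr => kk _; rewrite !mxE.
Qed.

End Tangents.

(** * The parametrisation of Xt *)

Section SignedCoordinates.
Variables (K : closedFieldType) (t n m : nat).
Local Notation Pt := 'M[K]_(ext_dim t n, ext_dim t m).

Definition inc_fun k (i : 'I_(ext_dim t k)) : 'I_t -> 'I_k :=
  val (@enum_val _ {: Inc t k} i).

Definition srt k (al : 'I_t -> 'I_k) : option ('I_(ext_dim t k) * {perm 'I_t}) :=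
  [pick z : 'I_(ext_dim t k) * {perm 'I_t} |
    [forall a, al a == inc_fun z.1 (z.2 a)]].

(** Counting the smaller values gives the position of each value, and these positions form the
    sorting permutation. *)
Lemma injective_incr k (al : 'I_t -> 'I_k) : injective al ->
  exists i (s : {perm 'I_t}), al =1 inc_fun i \o s.
Proof.
move=> inj; pose low a := [set l : 'I_t | (al l < al a)%N].
have lowt a : (#|low a| < t)%N.
  rewrite -[X in (_ < X)%N](card_ord t); apply: (@proper_card _ _ predT).
  apply/properP; split; first exact/subsetP.
  by exists a => //; rewrite inE ltnn.
pose r a := Ordinal (lowt a).
have mono a b : (al a < al b)%N -> (r a < r b)%N.
  move=> ab; apply: proper_card; apply/properP; split.
    by apply/subsetP => l; rewrite !inE => /ltn_trans; apply.
  by exists a; rewrite !inE ?ltnn.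
have rinj : injective r.
  move=> a b e; apply: inj; apply/val_inj => /=.
  by case: (ltngtP (al a) (al b)) => // /mono; rewrite e ltnn.
pose s := perm rinj; pose f : {ffun 'I_t -> 'I_k} := [ffun a => al (s^-1 a)%g].
have incf : incr f.
  apply/forallP => a; apply/forallP => b; apply/implyP => ab; rewrite !ffunE.
  case: ltngtP => // [/mono|/val_inj/inj/perm_inj e]; last by rewrite e ltnn in ab.
  have rs c : r (s^-1 c)%g = c by rewrite -[LHS](permE rinj) permKV.
  by rewrite !rs ltnNge ltnW.
exists (enum_rank (exist _ f incf : Inc t k)), s => a /=.
by rewrite /inc_fun enum_rankK /= ffunE permK.
Qed.

Lemma srt_some k (al : 'I_t -> 'I_k) i s : srt al = Some (i, s) -> al =1 inc_fun i \o s.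
Proof.
by rewrite /srt; case: pickP => // z h [e] a; move/forallP: h => /(_ a) /eqP ->; rewrite e.
Qed.

Lemma srt_none k (al : 'I_t -> 'I_k) : srt al = None -> ~~ injectiveb al.
Proof.
rewrite /srt; case: pickP => // h _; apply/negP => /injectiveP/injective_incr [i [s e]].
by have /forallP [] := h (i, s); move=> a; rewrite e.
Qed.

(* The (al, be)-coordinate for arbitrary (not necessarily increasing) index maps,
   extended from the coordinates of [y] by antisymmetry. *)
Definition lin (al : 'I_t -> 'I_n) (be : 'I_t -> 'I_m) (y : Pt) : K :=
  match srt al, srt be with
  | Some (i, s), Some (j, s') => (-1) ^+ s * (-1) ^+ s' * y i j
  | _, _ => 0
  end.

Lemma lin_linear al be a u v : lin al be (a *: u + v) = a * lin al be u + lin al be v.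
Proof.
rewrite /lin; case: (srt al) => [[i s]|]; last by rewrite mulr0 addr0.
case: (srt be) => [[j s']|]; last by rewrite mulr0 addr0.
rewrite mxE [X in _ * (X + _)]mxE.
by rewrite mulrDr mulrCA.
Qed.

Lemma lin_sum al be : exists (I : finType) u r r',
  forall y, lin al be y = \sum_(i : I) u i * y (r i) (r' i).
Proof.
rewrite /lin; case: (srt al) => [[i s]|].
  case: (srt be) => [[j s']|].
    exists unit, (fun=> (-1) ^+ s * (-1) ^+ s'), (fun=> i), (fun=> j) => y.
    by rewrite (big_pred1 tt) // => [] [].
  by exists void, (fun=> 0), (of_void _), (of_void _) => y; rewrite big_pred0 // => [] [].
by exists void, (fun=> 0), (of_void _), (of_void _) => y; rewrite big_pred0 // => [] [].
Qed.

Lemma lin_rank1 (g : 'I_(ext_dim t n) -> K) (h : 'I_(ext_dim t m) -> K) (y : Pt) :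
    (forall i j, y i j = g i * h j) ->
  exists G H, forall al be, lin al be y = G al * H be.
Proof.
move=> e.
exists (fun al => if srt al is Some (i, s) then (-1) ^+ s * g i else 0).
exists (fun be => if srt be is Some (i, s) then (-1) ^+ s * h i else 0) => al be.
rewrite /lin; case: (srt al) => [[i s]|]; last by rewrite mul0r.
by case: (srt be) => [[j s']|]; [rewrite e mulrACA | rewrite mulr0].
Qed.

Lemma fs_lin (Y : Type) (S : (Y -> K) -> Prop) (hS : fun_subalg S) (c : Y -> Pt) al be :
  (forall i j, S (fun y => c y i j)) -> S (fun y => lin al be (c y)).
Proof.
move=> hc; rewrite /lin; case: (srt al) => [[i s]|]; last exact: fs_cst.
case: (srt be) => [[j s']|]; last exact: fs_cst.
by apply: fs_mul => //; apply: fs_cst.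
Qed.

Definition psi (d : K) (P : 'M[K]_(n, t)) (Q : 'M_(t, m)) (T : 'M_(n, m)) (B : 'M_t) : Pt :=
  \matrix_(i, j) (d * bdet P Q T B (inc_fun i) (inc_fun j)).

Lemma lin_psi d P Q T B al be : lin al be (psi d P Q T B) = d * bdet P Q T B al be.
Proof.
rewrite /lin; case Ea : (srt al) => [[i s]|]; last first.
  by rewrite bdet_noninjl ?mulr0 // srt_none.
case Eb : (srt be) => [[j s']|]; last by rewrite bdet_noninjr ?mulr0 // srt_none.
rewrite mxE (eq_bdet _ _ _ _ (srt_some Ea) (srt_some Eb)) bdet_perm.
by rewrite mulrCA.
Qed.

Lemma wedge_psi phi : wedge_mx t phi = psi 1 0 0 phi 1%:M.
Proof.
apply/matrixP => i j; rewrite !mxE mul1r bdet_minor.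
by congr (\det _); apply/matrixP => a b; rewrite !mxE.
Qed.

Lemma lin_wedge phi al be : lin al be (wedge_mx t phi) = \det (mxsub al be phi).
Proof. by rewrite wedge_psi lin_psi mul1r bdet_minor. Qed.

(** The pair chosen by [srt] need not be compared with i and j: the identity holds on exterior
    powers, where it is an equality of minors, and extends to the closure as a polynomial
    equation. *)
Lemma lin_Xt al be i j (x : Pt) : al =1 inc_fun i -> be =1 inc_fun j ->
  Xt x -> lin al be x = x i j.
Proof.
move=> ea eb Xx.
have [f hf] : polyfun (fun y : Pt => lin al be y - y i j).
  apply: (fs_sub (polyfun_subalg K _ _)); last exact: polyfun_coord.
  by apply: (fs_lin (polyfun_subalg K _ _)) => k l; apply: polyfun_coord.
apply/eqP; rewrite -subr_eq0 -hf Xx // => _ [phi ->].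
rewrite hf lin_wedge wedge_psi mxE mul1r bdet_minor; apply/eqP; rewrite subr_eq0; apply/eqP.
by congr (\det _); apply/matrixP => a b; rewrite !mxE ea eb.
Qed.

Lemma fs_psi (Y : Type) (S : (Y -> K) -> Prop) (hS : fun_subalg S) d
    (P : Y -> 'M[K]_(n, t)) (Q : Y -> 'M_(t, m)) (T : Y -> 'M_(n, m)) (B : Y -> 'M_t) :
    S d ->
    (forall i j, S (fun y => P y i j)) -> (forall i j, S (fun y => Q y i j)) ->
    (forall i j, S (fun y => T y i j)) -> (forall i j, S (fun y => B y i j)) ->
  forall i j, S (fun y => psi (d y) (P y) (Q y) (T y) (B y) i j).
Proof.
move=> hd hP hQ hT hB i j.
apply: (fs_ext hS) (fs_mul hS hd (fs_bdet hS (inc_fun i) (inc_fun j) hP hQ hT hB)).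
by move=> y; rewrite mxE.
Qed.

Hypothesis t_gt0 : (0 < t)%N.

(** A t-th root of d * \det B exists in K; rescaling the map by it absorbs this factor into every t
    x t minor. *)
Lemma psi_unit_wedge d P Q T B : B \in unitmx ->
  exists phi, psi d P Q T B = wedge_mx t phi.
Proof.
move=> uB; have : size ('X^t - (d * \det B)%:P) != 1%N by rewrite size_XnsubC // -lt0n.
move/closed_rootP => [c]; rewrite rootE hornerD hornerN hornerC hornerXn subr_eq0.
move=> /eqP ec; exists (c *: (T + P *m invmx B *m Q)).
apply/matrixP => i j; rewrite wedge_psi !mxE mul1r bdet_minor bdet_schur //.
rewrite mulrA -ec -detZ; congr (\det _).
by apply/matrixP => a b; rewrite !mxE.
Qed.

(* Points with invertible [B] are dense on the line [B + a%:M]. *)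
Lemma psi_Xt d P Q T B : Xt (psi d P Q T B).
Proof.
move=> f fX; have hS := upoly_subalg K.
have [F hF] : upoly (fun a => ev f (psi d P Q T (B + a%:M))).
  apply: (fs_ev hS) => i j; apply: (fs_psi hS) => *; try exact: (fs_cst hS).
  apply: (fs_ext hS (f := fun a => B _ _ + a * (_ == _)%:R)) => [a|].
    by rewrite !mxE mulr_natr.
  by apply: (fs_add hS); [exact: (fs_cst hS) | apply: (fs_mul hS);
     [exact: upolyX | exact: (fs_cst hS)]].
have G a : (char_poly (- B)).[a] = \det (B + a%:M).
  rewrite -[LHS]/(horner_eval a _) -det_map_mx; congr (\det _).
  apply/matrixP => i j; rewrite !mxE /= /horner_eval hornerD hornerN hornerMn hornerX.
  by rewrite hornerC opprK addrC.
have : F * char_poly (- B) = 0.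
  apply: horner_inj => a; rewrite hornerM hF G horner0.
  have [->|nz] := eqVneq (\det (B + a%:M)) 0; first by rewrite mulr0.
  have [|phi ->] := @psi_unit_wedge d P Q T (B + a%:M).
    by rewrite unitmxE unitfE.
  by rewrite fX ?mul0r //; exists phi.
move/eqP; rewrite mulf_eq0 (negPf (monic_neq0 (char_poly_monic _))) orbF => /eqP F0.
by have := hF 0; rewrite F0 horner0 raddf0 addr0.
Qed.

End SignedCoordinates.

(** * Charts *)

Lemma upd_id t k (f : 'I_t -> 'I_k) a : upd f a (f a) =1 f.
Proof. by move=> l; rewrite /upd; case: eqP => [->|]. Qed.

Section Charts.
Variables (K : closedFieldType) (t n' m' : nat).
Variables (rho : {perm 'I_(t + n')}) (rho' : {perm 'I_(t + m')}).
Hypothesis t_gt0 : (0 < t)%N.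
Local Notation Pt := 'M[K]_(ext_dim t (t + n'), ext_dim t (t + m')).
Local Notation X := (@Xt K (t + m') (t + n') t).
Implicit Types (p : 'M[K]_(n', t)) (q : 'M[K]_(t, m')) (T : 'M[K]_(n', m')).
Implicit Types (B : 'M[K]_t) (y : Pt).

(** The scalar d is 1 on the chart itself; other values serve the formulas without denominators. *)
Definition fullP (d : K) p : 'M[K]_(t + n', t) := row_perm rho (col_mx d%:M p).
Definition fullQ (d : K) q : 'M[K]_(t, t + m') := col_perm rho' (row_mx d%:M q).
Definition fullT T : 'M[K]_(t + n', t + m') :=
  row_perm rho (col_perm rho' (block_mx 0 0 0 T)).

Definition cpsi d p q T B : Pt := psi d (fullP 1 p) (fullQ 1 q) (fullT T) B.

Definition row0 (k : 'I_t) : 'I_(t + n') := (rho^-1)%g (lshift n' k).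
Definition row1 (c : 'I_n') : 'I_(t + n') := (rho^-1)%g (rshift t c).
Definition col0 (k : 'I_t) : 'I_(t + m') := (rho'^-1)%g (lshift m' k).
Definition col1 (e : 'I_m') : 'I_(t + m') := (rho'^-1)%g (rshift t e).

Definition x0 : Pt -> K := lin row0 col0.
Definition xp c a : Pt -> K := lin (upd row0 a (row1 c)) col0.
Definition xq b e : Pt -> K := lin row0 (upd col0 b (col1 e)).
Definition xm c a e b : Pt -> K := lin (upd row0 a (row1 c)) (upd col0 b (col1 e)).
(* On [cpsi d p q T B] this is [d ^+ 2 * (T c e * B b a)]. *)
Definition xM c a e b y : K := x0 y * xm c a e b y - xp c a y * xq b e y.

Lemma fullP0 d p k l : fullP d p (row0 k) l = d *+ (k == l).
Proof. by rewrite /fullP mxE permKV col_mxEu mxE. Qed.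
Lemma fullP1 d p c l : fullP d p (row1 c) l = p c l.
Proof. by rewrite /fullP mxE permKV col_mxEd. Qed.
Lemma fullQ0 d q k l : fullQ d q l (col0 k) = d *+ (l == k).
Proof. by rewrite /fullQ mxE permKV row_mxEl mxE. Qed.
Lemma fullQ1 d q e l : fullQ d q l (col1 e) = q l e.
Proof. by rewrite /fullQ mxE permKV row_mxEr. Qed.
Lemma fullTE T i j : fullT T i j = block_mx 0 0 0 T (rho i) (rho' j).
Proof. by rewrite /fullT [LHS]mxE [LHS]mxE. Qed.
Lemma fullT_row0 T k i : fullT T (row0 k) i = 0.
Proof.
rewrite fullTE permKV; case: (split_ordP (rho' i)) => i' ->.
  by rewrite block_mxEul mxE.
by rewrite block_mxEur mxE.
Qed.
Lemma fullT_col0 T k i : fullT T i (col0 k) = 0.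
Proof.
rewrite fullTE permKV; case: (split_ordP (rho i)) => i' ->.
  by rewrite block_mxEul mxE.
by rewrite block_mxEdl mxE.
Qed.
Lemma fullT1 T c e : fullT T (row1 c) (col1 e) = T c e.
Proof. by rewrite fullTE !permKV block_mxEdr. Qed.

Lemma scale_fullP c d p : c *: fullP d p = fullP (c * d) (c *: p).
Proof.
apply/matrixP => i j; rewrite !mxE; case: split => k; rewrite !mxE //.
by rewrite mulrnAr.
Qed.
Lemma scale_fullQ c d q : c *: fullQ d q = fullQ (c * d) (c *: q).
Proof.
apply/matrixP => i j; rewrite !mxE; case: split => k; rewrite !mxE //.
by rewrite mulrnAr.
Qed.
Lemma scale_fullT c T : c *: fullT T = fullT (c *: T).
Proof.
apply/matrixP => i j; rewrite mxE !fullTE; case: (split_ordP (rho i)) => k ->;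
  case: (split_ordP (rho' j)) => l ->;
  by rewrite ?block_mxEul ?block_mxEur ?block_mxEdl ?block_mxEdr ?mxE ?mulr0.
Qed.

Lemma bdet_chart p q T B j i a b :
  bdet (fullP 1 p) (fullQ 1 q) (fullT T) B (upd row0 a j) (upd col0 b i) =
  fullP 1 p j a * fullQ 1 q b i + fullT T j i * B b a.
Proof.
apply: bdet_special => *; rewrite ?fullP0 ?fullQ0 //; [exact: fullT_row0|exact: fullT_col0].
Qed.

Let i0 := Ordinal t_gt0.

Lemma x0_cpsi d p q T B : x0 (cpsi d p q T B) = d.
Proof.
rewrite /x0 lin_psi -(eq_bdet _ _ _ _ (upd_id row0 i0) (upd_id col0 i0)) bdet_chart.
by rewrite fullP0 fullQ0 fullT_row0 eqxx mul0r addr0 !mulr1.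
Qed.

Lemma xp_cpsi d p q T B c a : xp c a (cpsi d p q T B) = d * p c a.
Proof.
rewrite /xp lin_psi -(eq_bdet _ _ _ _ (frefl _) (upd_id col0 i0)) bdet_chart.
by rewrite fullP1 fullQ0 fullT_col0 eqxx mul0r addr0 !mulr1.
Qed.

Lemma xq_cpsi d p q T B b e : xq b e (cpsi d p q T B) = d * q b e.
Proof.
rewrite /xq lin_psi -(eq_bdet _ _ _ _ (upd_id row0 i0) (frefl _)) bdet_chart.
by rewrite fullP0 fullQ1 fullT_row0 eqxx mul0r addr0 mul1r.
Qed.

Lemma xm_cpsi d p q T B c a e b :
  xm c a e b (cpsi d p q T B) = d * (p c a * q b e + T c e * B b a).
Proof. by rewrite /xm lin_psi bdet_chart fullP1 fullQ1 fullT1. Qed.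

Definition x_cpsi := (x0_cpsi, xp_cpsi, xq_cpsi, xm_cpsi).

Lemma xM_cpsi d p q T B c a e b :
  xM c a e b (cpsi d p q T B) = (d * T c e) * (d * B b a).
Proof. by rewrite /xM !x_cpsi; ring. Qed.

Lemma cpsi_Xt d p q T B : X (cpsi d p q T B).
Proof. exact: psi_Xt. Qed.

Lemma wedge_chart phi : x0 (wedge_mx t phi) != 0 ->
  exists d p q T B, wedge_mx t phi = cpsi d p q T B.
Proof.
rewrite /x0 lin_wedge; pose phi' := row_perm rho^-1 (col_perm rho'^-1 phi).
pose A := ulsubmx phi'; have -> : mxsub row0 col0 phi = A.
  by apply/matrixP => k l; rewrite !mxE.
move=> dA; have uA : A \in unitmx by rewrite unitmxE unitfE.
(* Block elimination: T is the Schur complement of A, while d and B become \det A and A^-1. *)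
pose p := dlsubmx phi' *m invmx A; pose q := invmx A *m ursubmx phi'.
pose T := drsubmx phi' - p *m ursubmx phi'.
exists (\det A), p, q, T, (invmx A).
have e : fullT T + fullP 1 p *m A *m fullQ 1 q = phi.
  have -> : phi = row_perm rho (col_perm rho' phi').
    by apply/matrixP => k l; rewrite !mxE !permK.
  have -> : phi' = block_mx 0 0 0 T + col_mx 1%:M p *m A *m row_mx 1%:M q.
    rewrite mul_col_mx mul_col_row mul1mx add_block_mx !mulmx1 !add0r.
    rewrite /q mulKVmx // -[p *m A *m _]mulmxA mulKVmx // /T subrK.
    by rewrite /p mulmxKV // -[LHS]submxK.
  rewrite /fullT /fullP /fullQ !row_permE !col_permE !mulmxDl mulmxDr.
  by rewrite !mulmxA.
apply/matrixP => i j; rewrite wedge_psi !mxE mul1r bdet_minor.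
rewrite bdet_schur ?unitmx_inv // invmxK e det_inv mulrA divff // mul1r //.
Qed.

(** Exterior powers outside the chart have [x0] equal to 0, so the factor [x0] turns an identity in
    the parameters into an equation of all of [Xt]. *)
Lemma chart_identity (F : Pt -> K) : polyfun F ->
    (forall d p q T B, F (cpsi d p q T B) = 0) ->
  exists2 f, vanishes X f & forall y, ev f y = x0 y * F y.
Proof.
move=> pF hF; have hS := polyfun_subalg K (ext_dim t (t + n')) (ext_dim t (t + m')).
have [f hf] : polyfun (fun y : Pt => x0 y * F y).
  apply: (fs_mul hS) => //; apply: (fs_lin hS) => i j; exact: polyfun_coord.
exists f => //; apply: vanishes_zclosure => _ [phi ->]; rewrite hf.
have [->|/wedge_chart] := eqVneq (x0 (wedge_mx t phi)) 0; first by rewrite mul0r.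
by move=> [d [p [q [T [B ->]]]]]; rewrite hF mulr0.
Qed.

Lemma chart_identityP (F : Pt -> K) y : polyfun F ->
    (forall d p q T B, F (cpsi d p q T B) = 0) -> X y -> x0 y != 0 -> F y = 0.
Proof.
move=> pF hF Xy y0; have [f fX hf] := chart_identity pF hF.
by have := hf y; rewrite fX // => /esym/eqP; rewrite mulf_eq0 (negPf y0) => /eqP.
Qed.

Let hS := polyfun_subalg K (ext_dim t (t + n')) (ext_dim t (t + m')).

Lemma polyfun_lin al be : polyfun (fun y : Pt => lin al be y).
Proof. by apply: (fs_lin hS) => i j; apply: polyfun_coord. Qed.

Lemma polyfun_xM c a e b : polyfun (fun y => xM c a e b y).
Proof. by apply: (fs_sub hS); apply: (fs_mul hS); apply: polyfun_lin. Qed.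

Definition hatp y : 'M[K]_(n', t) := \matrix_(c, a) xp c a y.
Definition hatq y : 'M[K]_(t, m') := \matrix_(b, e) xq b e y.

Section FullEntries.
Variables (Y : Type) (S : (Y -> K) -> Prop) (hF : fun_subalg S).

Lemma fs_fullP (u : Y -> K) (v : Y -> 'M_(n', t)) :
    S u -> (forall i j, S (fun z => v z i j)) ->
  forall i j, S (fun z => fullP (u z) (v z) i j).
Proof.
move=> hu hv i j; rewrite -[i](permK rho); case: (split_ordP (rho i)) => k ->.
  apply: (fs_ext hF (f := fun z => u z * (k == j)%:R)) => [z|].
    by rewrite (fullP0 _ _ k) mulr_natr.
  by apply: (fs_mul hF) => //; apply: (fs_cst hF).
by apply: (fs_ext hF) (hv k j) => z; rewrite (fullP1 _ _ k).
Qed.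

Lemma fs_fullQ (u : Y -> K) (v : Y -> 'M_(t, m')) :
    S u -> (forall i j, S (fun z => v z i j)) ->
  forall i j, S (fun z => fullQ (u z) (v z) i j).
Proof.
move=> hu hv i j; rewrite -[j](permK rho'); case: (split_ordP (rho' j)) => k ->.
  apply: (fs_ext hF (f := fun z => u z * (i == k)%:R)) => [z|].
    by rewrite (fullQ0 _ _ k) mulr_natr.
  by apply: (fs_mul hF) => //; apply: (fs_cst hF).
by apply: (fs_ext hF) (hv i k) => z; rewrite (fullQ1 _ _ k).
Qed.

Lemma fs_fullT (v : Y -> 'M_(n', m')) :
    (forall i j, S (fun z => v z i j)) ->
  forall i j, S (fun z => fullT (v z) i j).
Proof.
move=> hv i j; rewrite -[i](permK rho) -[j](permK rho').
case: (split_ordP (rho i)) => k ->.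
  by apply: (fs_ext hF) (fs_cst hF 0) => z; rewrite (fullT_row0 _ k).
case: (split_ordP (rho' j)) => l ->.
  by apply: (fs_ext hF) (fs_cst hF 0) => z; rewrite (fullT_col0 _ l).
by apply: (fs_ext hF) (hv k l) => z; rewrite (fullT1 _ k l).
Qed.

Lemma fs_cpsi (d : Y -> K) (p : Y -> 'M_(n', t)) (q : Y -> 'M_(t, m'))
    (T : Y -> 'M_(n', m')) (B : Y -> 'M_t) :
    S d ->
    (forall i j, S (fun z => p z i j)) -> (forall i j, S (fun z => q z i j)) ->
    (forall i j, S (fun z => T z i j)) -> (forall i j, S (fun z => B z i j)) ->
  forall i j, S (fun z => cpsi (d z) (p z) (q z) (T z) (B z) i j).
Proof.
move=> hd hp hq hT hB; apply: (fs_psi hF) => //.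
- by apply: fs_fullP => //; apply: (fs_cst hF).
- by apply: fs_fullQ => //; apply: (fs_cst hF).
- exact: fs_fullT.
Qed.

End FullEntries.

Definition hatM y (j : 'I_(t + n')) (i : 'I_(t + m')) (b a : 'I_t) : K :=
  match split (rho j), split (rho' i) with
  | inr c, inr e => xM c a e b y
  | _, _ => 0
  end.

Lemma hat_cpsi d p q T B : (hatp (cpsi d p q T B) = d *: p) *
  (hatq (cpsi d p q T B) = d *: q).
Proof. by split; apply/matrixP => i j; rewrite !mxE x_cpsi. Qed.

(** Multiplying all 2 * t rows of the determinant by [x0] turns p and q into [hatp] and [hatq], and
    T_ji B_ba into [xM]. Hence a point of the chart is determined by the minors differing from the
    distinguished one in at most one row and one column. *)
Lemma pairing_identity y i j : X y -> x0 y != 0 ->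
  x0 y ^+ (2 * t) * y i j =
  x0 y * bpair (fullP (x0 y) (hatp y)) (fullQ (x0 y) (hatq y)) (hatM y)
                 (inc_fun i) (inc_fun j).
Proof.
move=> Xy y0; apply/eqP; rewrite -subr_eq0; apply/eqP.
pose F y := x0 y ^+ (2 * t) * y i j - x0 y * bpair (fullP (x0 y) (hatp y))
  (fullQ (x0 y) (hatq y)) (hatM y) (inc_fun i) (inc_fun j).
apply: (@chart_identityP F y _ _ Xy y0) => [|d p q T B].
  apply: (fs_sub hS); apply: (fs_mul hS).
  - by apply: (fs_exp hS); apply: polyfun_lin.
  - exact: polyfun_coord.
  - exact: polyfun_lin.
  apply: (fs_bpair hS) => [i' j'|i' j'|i' j' b a].
  - apply: (fs_fullP hS); first exact: polyfun_lin.
    by move=> c a; apply: (fs_ext hS) (polyfun_lin _ _) => z; rewrite mxE.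
  - apply: (fs_fullQ hS); first exact: polyfun_lin.
    by move=> c a; apply: (fs_ext hS) (polyfun_lin _ _) => z; rewrite mxE.
  rewrite /hatM; case: split => c; first exact: (fs_cst hS).
  by case: split => e; [exact: (fs_cst hS) | exact: polyfun_xM].
rewrite /F x_cpsi !hat_cpsi mxE -(@bdet_pair _ _ _ _ _ _ (d *: fullT T) (d *: B)).
  have := @bdet_scale _ _ _ _ d 1 1 d (fullP 1 p) (fullQ 1 q) (fullT T) B (inc_fun i) (inc_fun j).
  rewrite !mulr1 scale_fullP scale_fullQ !mulr1 => ->.
  by rewrite -expr2 -exprM mulrCA subrr.
move=> j' i' b a; rewrite /hatM [(_ *: fullT _) _ _]mxE fullTE [(_ *: B) _ _]mxE.
case: (split_ordP (rho j')) => k ->; case: (split_ordP (rho' i')) => l ->;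
  rewrite ?block_mxEul ?block_mxEur ?block_mxEdl ?block_mxEdr ?mxE ?mulr0 ?mul0r //.
by rewrite xM_cpsi.
Qed.

(** When all products vanish, B drops out of the formula and may be chosen at will; [rank1_jacobian]
    exploits this. *)
Lemma degenerate_chart y B : X y -> x0 y != 0 ->
    (forall c a e b, xM c a e b y = 0) ->
  y = cpsi (x0 y) ((x0 y)^-1 *: hatp y) ((x0 y)^-1 *: hatq y) 0 B.
Proof.
move=> Xy y0 M0; apply/matrixP => i j.
apply: (mulfI (expf_neq0 (2 * t) y0)); rewrite pairing_identity // mxE.
rewrite -(@bdet_pair _ _ _ _ _ _ (x0 y *: fullT 0) (x0 y *: B)); last first.
  move=> j' i' b a; rewrite scale_fullT scaler0 /hatM fullTE.
  case: (split_ordP (rho j')) => k ->; case: (split_ordP (rho' i')) => l ->;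
    by rewrite ?block_mxEul ?block_mxEur ?block_mxEdl ?block_mxEdr ?mxE ?mul0r ?M0.
have := @bdet_scale _ _ _ _ (x0 y) 1 1 (x0 y) (fullP 1 ((x0 y)^-1 *: hatp y))
   (fullQ 1 ((x0 y)^-1 *: hatq y)) (fullT 0) B (inc_fun i) (inc_fun j).
rewrite !mulr1 scale_fullP scale_fullQ !mulr1 !scalerA divff // !scale1r => ->.
by rewrite -expr2 -exprM mulrCA.
Qed.

Section Tangents.

Let lp (u v : K) : {poly K} := u%:P + v%:P * 'X.
Let horner_lp u v a : (lp u v).[a] = u + a * v.
Proof. by rewrite hornerD hornerM !hornerC hornerX mulrC. Qed.
Let deriv_lp u v : (lp u v)^`() = v%:P.
Proof. by rewrite derivD derivM !derivC derivX mul0r !add0r mulr1. Qed.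

Lemma cpsi_tangent d p q T B d1 p1 q1 T1 B1 : exists y,
  [/\ tangent X (cpsi d p q T B) y, x0 y = d1,
      forall c a, xp c a y = d1 * p c a + d * p1 c a,
      forall b e, xq b e y = d1 * q b e + d * q1 b e &
      forall c a e b, xm c a e b y = d1 * (p c a * q b e + T c e * B b a) +
        d * (p1 c a * q b e + p c a * q1 b e + (T1 c e * B b a + T c e * B1 b a))].
Proof.
pose cv a := cpsi (d + a * d1) (p + a *: p1) (q + a *: q1) (T + a *: T1) (B + a *: B1).
have line (u v : K) : upoly (fun a => u + a * v).
  by exists (lp u v) => a; rewrite horner_lp.
have pcv : polycurve cv.
  apply: (fs_cpsi (upoly_subalg K)) => [|i j|i j|i j|i j]; first exact: line;
  by apply: (fs_ext (upoly_subalg K)) (line _ _) => a; rewrite !mxE.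
have [y] := curve_tangent pcv (fun a => cpsi_Xt _ _ _ _ _ : X (cv a)).
rewrite /cv !mul0r !scale0r !addr0 => ty hy.
have hl al be (P : {poly K}) : (forall a, lin al be (cv a) = P.[a]) -> lin al be y = P^`().[0].
  have [I [u [r [r' e]]]] := lin_sum K al be.
  by move=> h; rewrite e; apply: hy => a; rewrite -e h.
exists y; split=> //.
- rewrite /x0 (hl _ _ (lp d d1)) ?deriv_lp ?hornerC // => a.
  by rewrite horner_lp -/(x0 _) x_cpsi.
- move=> c a; rewrite /xp (hl _ _ (lp d d1 * lp (p c a) (p1 c a))) => [|z].
    by rewrite derivM !deriv_lp hornerD !hornerM !hornerC !horner_lp; ring.
  by rewrite hornerM !horner_lp -/(xp _ _ _) x_cpsi !mxE.
- move=> b e; rewrite /xq (hl _ _ (lp d d1 * lp (q b e) (q1 b e))) => [|z].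
    by rewrite derivM !deriv_lp hornerD !hornerM !hornerC !horner_lp; ring.
  by rewrite hornerM !horner_lp -/(xq _ _ _) x_cpsi !mxE.
move=> c a e b.
rewrite /xm (hl _ _ (lp d d1 * (lp (p c a) (p1 c a) * lp (q b e) (q1 b e) +
                                lp (T c e) (T1 c e) * lp (B b a) (B1 b a)))) => [|z].
  by rewrite derivM deriv_lp derivD !derivM !deriv_lp /lp !hornerE; ring.
by rewrite hornerM horner_lp hornerD !hornerM !horner_lp -/(xm _ _ _ _ _) x_cpsi !mxE.
Qed.

End Tangents.

(** * Tangent spaces at points of rank at most 1 *)

Definition rank1_slot : finType :=
  (unit + ('I_n' * 'I_t + ('I_t * 'I_m' + ('I_n' * 'I_t) * ('I_m' * 'I_t))))%type.

(** The difference of the two sides is (t ^ 2 - 1) * (n' * m' - 1). *)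
Lemma card_rank1_slot : (1 < t)%N -> (1 < n' * m')%N ->
  ((t + n') * (t + m') < #|rank1_slot|)%N.
Proof.
move=> t1 nm1; rewrite /rank1_slot !(card_sum, card_prod) card_unit !card_ord.
by clear -t1 nm1; nia.
Qed.

Definition rank1_lin (s : rank1_slot) : Pt -> K :=
  match s with
  | inl _ => x0
  | inr (inl (c, a)) => xp c a
  | inr (inr (inl (b, e))) => xq b e
  | inr (inr (inr ((c, a), (e, b)))) => xm c a e b
  end.

Lemma rank1_lin_linear s a u v : rank1_lin s (a *: u + v) = a * rank1_lin s u + rank1_lin s v.
Proof. by case: s => [?|[[? ?]|[[? ?]|[[? ?] [? ?]]]]]; apply: lin_linear. Qed.

Local Notation N := (ext_dim t (t + n') * ext_dim t (t + m'))%N.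

Lemma delta_mx_neq (R : pzRingType) k l (i i' : 'I_k) (j j' : 'I_l) :
  (i, j) != (i', j') -> delta_mx i j i' j' = 0 :> R.
Proof.
rewrite mxE; case: andP => // -[/eqP -> /eqP ->]; by rewrite eqxx.
Qed.

(** With B and the velocity of T elementary matrices, a single coordinate [xm] moves: at its vertex,
    the cone of rank-one matrices has the whole ambient space as tangent space. *)
Lemma rank1_jacobian d p q (x : Pt) : d != 0 -> (forall B, x = cpsi d p q 0 B) ->
  forall k (fs : 'I_k -> {mpoly K[N]}), (forall i, vanishes X (fs i)) ->
    (\rank (jacobian fs x) + #|rank1_slot| <= N)%N.
Proof.
move=> d0 hx.
(* Moving d, p or q may also move coordinates of larger weight, which the triangular shape
   permits. *)
pose W (s : rank1_slot) :=
  match s with inl _ => 0%N | inr (inr (inr _)) => 2%N | _ => 1%N end.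
apply: (rank_tangents (l := rank1_lin) (W := W) rank1_lin_linear).
case=> [[]|[[c a]|[[b e]|[[c a] [e b]]]]].
- have [y []] := cpsi_tangent d p q 0 0 1 0 0 0 0.
  rewrite -hx => ty y0 yp yq ym; exists y; split=> //=; first by rewrite y0 oner_eq0.
  by case=> [[]|[[? ?]|[[? ?]|[[? ?] [? ?]]]]] //; rewrite eqxx.
- have [y []] := cpsi_tangent d p q 0 0 0 (delta_mx c a) 0 0 0.
  rewrite -hx => ty y0 yp yq ym; exists y; split=> //=.
    by rewrite yp mxE !eqxx mul0r add0r mulr1.
  case=> [[]|[[c' a']|[[b' e']|[[c' a'] [e' b']]]]] //= ne _.
    by rewrite yp mul0r add0r delta_mx_neq ?mulr0.
  by rewrite yq mxE mul0r mulr0 addr0.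
- have [y []] := cpsi_tangent d p q 0 0 0 0 (delta_mx b e) 0 0.
  rewrite -hx => ty y0 yp yq ym; exists y; split=> //=.
    by rewrite yq mxE !eqxx mul0r add0r mulr1.
  case=> [[]|[[c' a']|[[b' e']|[[c' a'] [e' b']]]]] //= ne _.
    by rewrite yp mxE mul0r mulr0 addr0.
  by rewrite yq mul0r add0r delta_mx_neq ?mulr0.
have [y []] := cpsi_tangent d p q 0 (delta_mx b a) 0 0 0 (delta_mx c e) 0.
rewrite -hx => ty y0 yp yq ym; exists y; split=> //=.
  by rewrite ym !mxE !eqxx !(mul0r, mulr0, addr0, add0r, mulr1).
case=> [[]|[[c' a']|[[b' e']|[[c' a'] [e' b']]]]] //= ne _.
- by rewrite yp mxE mul0r mulr0 addr0.
- by rewrite yq mxE mul0r mulr0 addr0.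
rewrite ym !mxE !(mul0r, mulr0, addr0, add0r) -natrM mulnb.
by case: andP ne => [[/andP [/eqP -> /eqP ->] /andP [/eqP -> /eqP ->]]|]; rewrite ?eqxx ?mulr0.
Qed.

(* [X] is a cone, so its tangent space at the origin contains [X]. *)
Lemma zero_jacobian k (fs : 'I_k -> {mpoly K[N]}) : (forall i, vanishes X (fs i)) ->
  (\rank (jacobian fs (0 : Pt)) + #|rank1_slot| <= N)%N.
Proof.
(* Each curve used is a line from the origin to a point with [x0] equal to 1, so the form [x0] gets
   the largest weight. *)
move: k fs; pose W (s : rank1_slot) := if s is inl _ then 1%N else 0%N.
have cpsi0 p q T B : cpsi 0 p q T B = 0.
  by apply/matrixP => i j; rewrite !mxE mul0r.
apply: (rank_tangents (l := rank1_lin) (W := W) rank1_lin_linear).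
case=> [[]|[[c a]|[[b e]|[[c a] [e b]]]]].
- have [y []] := cpsi_tangent 0 0 0 0 0 1 0 0 0 0.
  rewrite cpsi0 => ty y0 yp yq ym; exists y; split=> //=; first by rewrite y0 oner_eq0.
  case=> [[]|[[c' a']|[[b' e']|[[c' a'] [e' b']]]]] ne _;
    [by rewrite eqxx in ne | rewrite /= | rewrite /= | rewrite /=].
  + by rewrite yp !mxE mul0r mulr0 addr0.
  + by rewrite yq !mxE mul0r mulr0 addr0.
  + by rewrite ym !mxE !(mul0r, mulr0, addr0).
- have [y []] := cpsi_tangent 0 (delta_mx c a) 0 0 0 1 0 0 0 0.
  rewrite cpsi0 => ty y0 yp yq ym; exists y; split=> //=.
    by rewrite yp mxE !eqxx mul0r addr0 mulr1 oner_eq0.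
  case=> [[]|[[c' a']|[[b' e']|[[c' a'] [e' b']]]]] //= ne _.
  + by rewrite yp mul0r addr0 delta_mx_neq ?mulr0.
  + by rewrite yq !mxE !(mul0r, mulr0, addr0).
  + by rewrite ym !mxE !(mul0r, mulr0, addr0).
- have [y []] := cpsi_tangent 0 0 (delta_mx b e) 0 0 1 0 0 0 0.
  rewrite cpsi0 => ty y0 yp yq ym; exists y; split=> //=.
    by rewrite yq mxE !eqxx mul0r addr0 mulr1 oner_eq0.
  case=> [[]|[[c' a']|[[b' e']|[[c' a'] [e' b']]]]] //= ne _.
  + by rewrite yp !mxE !(mul0r, mulr0, addr0).
  + by rewrite yq mul0r addr0 delta_mx_neq ?mulr0.
  + by rewrite ym !mxE !(mul0r, mulr0, addr0).
have [y []] := cpsi_tangent 0 0 0 (delta_mx c e) (delta_mx b a) 1 0 0 0 0.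
rewrite cpsi0 => ty y0 yp yq ym; exists y; split=> //=.
  by rewrite ym !mxE !eqxx !(mul0r, mulr0, addr0, add0r, mulr1) oner_eq0.
case=> [[]|[[c' a']|[[b' e']|[[c' a'] [e' b']]]]] //= ne _.
- by rewrite yp !mxE !(mul0r, mulr0, addr0).
- by rewrite yq !mxE !(mul0r, mulr0, addr0).
rewrite ym !mxE !(mul0r, mulr0, addr0, add0r) -natrM mulnb.
by case: andP ne => [[/andP [/eqP -> /eqP ->] /andP [/eqP -> /eqP ->]]|]; rewrite ?eqxx ?mulr0.
Qed.

(** * Points with a nonzero product T_ji B_ba, and chains of full length *)

Section SmoothPoints.
Variables (c0 : 'I_n') (e0 : 'I_m') (a0 b0 : 'I_t).

Definition slot : finType := (('I_t + 'I_n') * ('I_t + 'I_m'))%type.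

Lemma card_slot : #|slot| = ((t + n') * (t + m'))%N.
Proof. by rewrite /slot card_prod !card_sum !card_ord. Qed.

(* A slot is an entry of a (t + n') x (t + m') matrix, in block form: the blocks hold
   the parameters [B], [p], [q], [T], except that the entry (c0, e0) of the last block
   holds [d], as the chart can be normalised to [T c0 e0 = 1]. *)
Definition slot_index (s : slot) : ('I_t -> 'I_(t + n')) * ('I_t -> 'I_(t + m')) :=
  match s with
  | (inl b, inl a) => (upd row0 a (row1 c0), upd col0 b (col1 e0))
  | (inr c, inl a) => (upd row0 a (row1 c), col0)
  | (inl b, inr e) => (row0, upd col0 b (col1 e))
  | (inr c, inr e) =>
      if (c == c0) && (e == e0) then (row0, col0)
      else (upd row0 a0 (row1 c), upd col0 b0 (col1 e))
  end.

Definition slot_lin s : Pt -> K := lin (slot_index s).1 (slot_index s).2.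

(** Holding one factor of the products fixed recovers the other up to a scalar: on the chart these
    are d ^ 2 * B b0 a0 times T and d ^ 2 * T c0 e0 times B. *)
Definition hatT y : 'M[K]_(n', m') := \matrix_(c, e) xM c a0 e b0 y.
Definition hatB y : 'M[K]_t := \matrix_(b, a) xM c0 a e0 b y.

Lemma slot_lin_hats y z : (forall s, slot_lin s y = slot_lin s z) ->
  [/\ x0 y = x0 z, hatp y = hatp z, hatq y = hatq z, hatT y = hatT z & hatB y = hatB z].
Proof.
move=> h; have h0 : x0 y = x0 z.
  by have := h (inr c0, inr e0); rewrite /slot_lin /= !eqxx.
have hp c a : xp c a y = xp c a z by apply: (h (inr c, inl a)).
have hq b e : xq b e y = xq b e z by apply: (h (inl b, inr e)).
have hB a b : xm c0 a e0 b y = xm c0 a e0 b z by apply: (h (inl b, inl a)).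
have hT c e : xm c a0 e b0 y = xm c a0 e b0 z.
  have := h (inr c, inr e); rewrite /slot_lin /=; case: andP => //= -[/eqP -> /eqP ->] _.
  exact: hB.
by split=> //; apply/matrixP => i j; rewrite !mxE /xM ?h0 ?hp ?hq ?hT ?hB.
Qed.

(** Recovers y i j from the slot coordinates, cleared of denominators. Products of entries of [hatT]
    and [hatB] exceed those in [xM] by the factor [xM c0 a0 e0 b0]; scaling P by the same factor
    restores homogeneity. *)
Definition smooth_eqn i j y : K :=
  x0 y ^+ (2 * t) * xM c0 a0 e0 b0 y ^+ t * y i j -
  x0 y * bdet (fullP (xM c0 a0 e0 b0 y * x0 y) (xM c0 a0 e0 b0 y *: hatp y))
    (fullQ (x0 y) (hatq y)) (fullT (hatT y)) (hatB y) (inc_fun i) (inc_fun j).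

Lemma smooth_eqn_polyfun i j : polyfun (smooth_eqn i j).
Proof.
have hM c a e b := polyfun_xM c a e b.
have hp c a : polyfun (fun z => hatp z c a).
  by apply: (fs_ext hS) (polyfun_lin _ _) => z; rewrite mxE.
apply: (fs_sub hS); apply: (fs_mul hS); last first.
- apply: (fs_bdet hS).
  + apply: (fs_fullP hS); first by apply: (fs_mul hS) => //; apply: polyfun_lin.
    move=> c a; apply: (fs_ext hS) (fs_mul hS (hM c0 a0 e0 b0) (hp c a)) => z.
    by rewrite !mxE.
  + apply: (fs_fullQ hS); first exact: polyfun_lin.
    by move=> c a; apply: (fs_ext hS) (polyfun_lin _ _) => z; rewrite mxE.
  + apply: (fs_fullT hS) => c e.
    by apply: (fs_ext hS) (hM c a0 e b0) => z; rewrite mxE.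
  + by move=> b a; apply: (fs_ext hS) (hM c0 a e0 b) => z; rewrite mxE.
- exact: polyfun_lin.
- exact: polyfun_coord.
apply: (fs_mul hS); apply: (fs_exp hS) => //; exact: polyfun_lin.
Qed.

Lemma smooth_eqn_cpsi i j d p q T B : smooth_eqn i j (cpsi d p q T B) = 0.
Proof.
rewrite /smooth_eqn; set z := cpsi d p q T B.
have hd : x0 z = d by rewrite x_cpsi.
have hM c a e b : xM c a e b z = (d * T c e) * (d * B b a) by rewrite xM_cpsi.
pose ka := d * B b0 a0; pose la := d * T c0 e0.
have -> : hatT z = (ka * d) *: T.
  by apply/matrixP => c e; rewrite !mxE hM mulrC mulrA.
have -> : hatB z = (d * la) *: B.
  by apply/matrixP => c e; rewrite !mxE hM; rewrite mulrCA mulrA.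
rewrite hM hd !hat_cpsi -/ka -/la scalerA.
have := @bdet_scale _ _ _ _ (ka * d) 1 la d (fullP 1 p) (fullQ 1 q) (fullT T) B
  (inc_fun i) (inc_fun j).
rewrite !mulr1 scale_fullP scale_fullQ scale_fullT !mulr1.
have -> : ka * d * la = la * ka * d by ring.
move=> ->; rewrite mxE.
have -> : la * ka * d * d = d ^+ 2 * (la * ka) by ring.
by rewrite [(d ^+ 2 * _) ^+ t]exprMn -exprM; ring.
Qed.

Definition mu y := xM c0 a0 e0 b0 y.

(** Among the choices of T and B differing by reciprocal scalars, this is the one with T c0 e0 =
    1. *)
Lemma smooth_chart y : X y -> x0 y != 0 -> mu y != 0 ->
  y = cpsi (x0 y) ((x0 y)^-1 *: hatp y) ((x0 y)^-1 *: hatq y)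
        ((mu y)^-1 *: hatT y) ((x0 y ^+ 2)^-1 *: hatB y).
Proof.
move=> Xy y0 my; apply/matrixP => i j.
have := chart_identityP (smooth_eqn_polyfun i j) (smooth_eqn_cpsi i j) Xy y0.
rewrite /smooth_eqn -/(mu y) => /eqP; rewrite subr_eq0 => /eqP e.
apply: (mulfI (mulf_neq0 (expf_neq0 (2 * t) y0) (expf_neq0 t my))).
rewrite e mxE; set p := _^-1 *: hatp y; set q := _^-1 *: hatq y.
set T := _^-1 *: hatT y; set B := _^-1 *: hatB y.
have := @bdet_scale _ _ _ _ (mu y) 1 (x0 y) (x0 y) (fullP 1 p) (fullQ 1 q)
  (fullT T) B (inc_fun i) (inc_fun j).
rewrite !mulr1 scale_fullP scale_fullQ scale_fullT !mulr1.
rewrite /p /q /T /B !scalerA mulfK // mulfV // !scale1r.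
rewrite mulfV // -expr2 mulfV ?expf_neq0 // !scale1r.
move=> ->.
have -> : mu y * x0 y * x0 y = x0 y ^+ 2 * mu y by ring.
by rewrite [(x0 y ^+ 2 * _) ^+ t]exprMn -exprM; ring.
Qed.

Lemma smooth_tangents (x : Pt) : X x -> x0 x != 0 -> mu x != 0 ->
  forall k (fs : 'I_k -> {mpoly K[N]}), (forall i, vanishes X (fs i)) ->
    (\rank (jacobian fs x) + #|slot| <= N)%N.
Proof.
move=> Xx x00 mx; have := smooth_chart Xx x00 mx.
set d := x0 x; set p := _ *: hatp x; set q := _ *: hatq x.
set T := _ *: hatT x; set B := _ *: hatB x => ex.
have T0 : T c0 e0 = 1 by rewrite !mxE mulVf.
have B0 : B b0 a0 != 0 by rewrite !mxE mulf_neq0 ?invr_neq0 ?expf_neq0.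
have d0 : d != 0 by [].
(* [x0] involves d only, [xp] and [xq] add p and q, the slots of B add B because T c0 e0 = 1, and
   those of T depend on everything before. *)
clearbody d p q T B; pose W (s : slot) := match s with
  | (inl _, inl _) => 2%N | (inr _, inl _) => 1%N | (inl _, inr _) => 1%N
  | (inr c, inr e) => if (c == c0) && (e == e0) then 0%N else 3%N end.
apply: (rank_tangents (l := slot_lin) (W := W) (fun s => lin_linear _ _)).
have linBE b a : slot_lin (inl b, inl a) = xm c0 a e0 b by [].
have linpE c a : slot_lin (inr c, inl a) = xp c a by [].
have linqE b e : slot_lin (inl b, inr e) = xq b e by [].
have linTE c e : slot_lin (inr c, inr e) =
    if (c == c0) && (e == e0) then x0 else xm c a0 e b0.
  by rewrite /slot_lin /=; case: ifP.
have linE := (linBE, linpE, linqE, linTE).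
case=> [[b|c] [a|e]].
- have [y []] := cpsi_tangent d p q T B 0 0 0 0 (delta_mx b a).
  rewrite -ex => ty y0 yp yq ym; exists y; split=> //.
    by rewrite linE ym T0 !mxE !eqxx !(mul0r, mulr0, add0r, addr0, mulr1).
  case=> [[b'|c'] [a'|e']] ne; rewrite linE /W.
  + by rewrite ym T0 delta_mx_neq ?mxE ?(mul0r, mulr0, add0r, addr0).
  + by rewrite yq !mxE !(mul0r, mulr0, add0r, addr0).
  + by rewrite yp !mxE !(mul0r, mulr0, add0r, addr0).
  + by case: ifP.
- have [y []] := cpsi_tangent d p q T B 0 0 (delta_mx b e) 0 0.
  rewrite -ex => ty y0 yp yq ym; exists y; split=> //.
    by rewrite linE yq !mxE !eqxx !(mul0r, mulr0, add0r, addr0, mulr1).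
  case=> [[b'|c'] [a'|e']] ne; rewrite linE /W //.
  + by rewrite yq delta_mx_neq // !(mul0r, mulr0, add0r, addr0).
  + by rewrite yp !mxE !(mul0r, mulr0, add0r, addr0).
  + by case: ifP.
- have [y []] := cpsi_tangent d p q T B 0 (delta_mx c a) 0 0 0.
  rewrite -ex => ty y0 yp yq ym; exists y; split=> //.
    by rewrite linE yp !mxE !eqxx !(mul0r, mulr0, add0r, addr0, mulr1).
  case=> [[b'|c'] [a'|e']] ne; rewrite linE /W //.
  + by rewrite yq !mxE !(mul0r, mulr0, add0r, addr0).
  + by rewrite yp delta_mx_neq // !(mul0r, mulr0, add0r, addr0).
  + by case: ifP.
case E : ((c == c0) && (e == e0)).
  have [y []] := cpsi_tangent d p q T B 1 0 0 0 0.
  rewrite -ex => ty y0 yp yq ym; exists y; split=> //.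
    by rewrite linE E y0 oner_eq0.
  case=> [[b'|c'] [a'|e']] ne; rewrite linE /W ?E //.
  case: ifP => // /andP [/eqP e1 /eqP e2]; case/andP: E => /eqP E1 /eqP E2.
  by rewrite E1 E2 e1 e2 eqxx in ne.
have [y []] := cpsi_tangent d p q T B 0 0 0 (delta_mx c e) 0.
rewrite -ex => ty y0 yp yq ym; exists y; split=> //.
  by rewrite linE E ym !mxE !eqxx !(mul0r, mulr0, add0r, addr0, mul1r) mulf_neq0.
case=> [[b'|c'] [a'|e']] ne; rewrite linE /W ?E // => _.
- rewrite ym delta_mx_neq ?mxE ?(mul0r, mulr0, add0r, addr0) //.
  by apply/negP => /eqP [ec ee]; rewrite ec ee !eqxx in E.
- by rewrite yq !mxE !(mul0r, mulr0, add0r, addr0).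
- by rewrite yp !mxE !(mul0r, mulr0, add0r, addr0).
case: ifP => // _.
by rewrite ym delta_mx_neq ?mxE ?(mul0r, mulr0, add0r, addr0).
Qed.

Definition slot_coord (s : slot) : option 'I_N :=
  match srt (slot_index s).1, srt (slot_index s).2 with
  | Some (i, _), Some (j, _) => Some (mxvec_index i j)
  | _, _ => None
  end.

Definition slot_coords : seq 'I_N := pmap slot_coord (enum slot).

Lemma slot_lin_line s (x : Pt) i j a : mxvec_index i j \notin slot_coords ->
  slot_lin s (x + a *: delta_mx i j) = slot_lin s x.
Proof.
move=> nij; rewrite addrC /slot_lin lin_linear.
suff -> : lin (slot_index s).1 (slot_index s).2 (delta_mx i j) = 0 :> K by rewrite mulr0 add0r.
have : slot_coord s != Some (mxvec_index i j).
  apply: contra nij => /eqP e; rewrite /slot_coords mem_pmap; apply/mapP.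
  by exists s; rewrite ?mem_enum.
rewrite /slot_coord /lin; case: (srt _) => // -[i' s1]; case: (srt _) => // -[j' s2] ne.
rewrite mxE; case: andP => [[/eqP e1 /eqP e2]|]; last by rewrite mulr0.
by rewrite e1 e2 eqxx in ne.
Qed.

Lemma mxvec_index_eq k l (i i' : 'I_k) (j j' : 'I_l) :
  (mxvec_index i j == mxvec_index i' j') = (i == i') && (j == j').
Proof.
apply/eqP/andP => [e|[/eqP -> /eqP -> //]].
have := congr1 (fun u => mxvec (\matrix_(v, w) (v, w)) 0 u) e.
by rewrite !mxvecE !mxE => -[-> ->].
Qed.

(** Each equation is affine in its own coordinate y i j and otherwise depends on slot coordinates
    only. On the columns outside the slots the Jacobian is thus a nonzero multiple of the
    identity. *)
Lemma smooth_equations (x : Pt) : x0 x != 0 -> mu x != 0 ->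
  exists k (fs : 'I_k -> {mpoly K[N]}), (forall i, vanishes X (fs i)) /\
    (N - #|slot| <= \rank (jacobian fs x))%N.
Proof.
move=> x00 mx; pose R := [set k | k \notin slot_coords].
have [f hf] : exists f : 'I_N -> {mpoly K[N]}, forall k, vanishes X (f k) /\
    forall i j, k = mxvec_index i j -> forall y, ev (f k) y = x0 y * smooth_eqn i j y.
  apply: (@fin_all_exists _ _ (fun k f => vanishes X f /\
    forall i j, k = mxvec_index i j -> forall y, ev f y = x0 y * smooth_eqn i j y)).
  case/mxvec_indexP=> i j.
  have [f fX hf] := chart_identity (smooth_eqn_polyfun i j) (smooth_eqn_cpsi i j).
  exists f; split=> // i' j' e y; rewrite hf; congr (_ * _).
  by move/eqP: e; rewrite mxvec_index_eq => /andP [/eqP -> /eqP ->].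
exists #|R|, (fun k => f (enum_val k)); split=> [k|]; first by case: (hf (enum_val k)).
set J := jacobian _ _.
(* The coefficient of y i j in [x0 y * smooth_eqn i j y]. *)
pose h := x0 x * (x0 x ^+ (2 * t) * mu x ^+ t).
have h0 : h != 0 by rewrite !mulf_neq0 ?expf_neq0.
pose C : 'M[K]_(N, #|R|) := \matrix_(u, v) (u == enum_val v)%:R.
have JC : J *m C = h%:M.
  apply/matrixP => k l; rewrite !mxE (bigD1 (enum_val l)) //= big1 ?addr0; last first.
    by move=> u ul; rewrite !mxE (negPf ul) mulr0.
  rewrite !mxE eqxx mulr1 -(inj_eq (@enum_val_inj _ _)); have [_] := hf (enum_val k).
  have := enum_valP l; rewrite inE; move: (enum_val l) (enum_val k).
  move=> l' k'; case/mxvec_indexP: l' => i' j'; case/mxvec_indexP: k' => i j.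
  move=> nij /(_ i j erefl) hk'.
  rewrite (@ev_mderiv _ _ _ _ x i' j' (x0 x * smooth_eqn i j x)
    (h * ((i == i') && (j == j'))%:R)).
    by rewrite mulr_natr mxvec_index_eq.
  move=> a; rewrite hk'.
  have [e1 e2 e3 e4 e5] := slot_lin_hats (fun s => slot_lin_line s x a nij).
  have e6 : mu (x + a *: delta_mx i' j') = mu x.
    by have := congr1 (fun M : 'M_(_, _) => M c0 e0) e4; rewrite !mxE.
  rewrite /smooth_eqn -!/(mu _) e1 e2 e3 e4 e5 e6 !mxE /h; ring.
have : \rank (J *m C) = #|R| by rewrite JC -scalemx1 mxrank_scale_nz // mxrank1.
move=> rJC; have := mxrankM_maxl J C; rewrite rJC; apply: leq_trans.
rewrite leq_subLR -[X in (X <= _)%N](card_ord N) -(cardC (mem slot_coords)) leq_add //.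
  apply: leq_trans (card_size _) _; rewrite size_pmap.
  by apply: leq_trans (count_size _ _) _; rewrite -cardE.
by apply: eq_leq; apply: eq_card => u; rewrite !inE.
Qed.

Definition slot_point (w : slot -> K) : Pt :=
  cpsi (w (inr c0, inr e0)) (\matrix_(c, a) w (inr c, inl a))
    (\matrix_(b, e) w (inl b, inr e))
    (\matrix_(c, e) if (c == c0) && (e == e0) then 1 else w (inr c, inr e))
    (\matrix_(b, a) w (inl b, inl a)).

(* Freeing the slots in order of increasing weight produces a chain in which each
   step is detected by the coordinate of the freed slot. *)
Definition slot_weight (s : slot) : nat :=
  match s with
  | (inl b, inl a) => if (b == b0) && (a == a0) then 1%N else 2%N
  | (inr c, inr e) => if (c == c0) && (e == e0) then 0%N else 2%N
  | _ => 3%N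
  end.

Lemma slot_lin_point s w : slot_lin s (slot_point w) =
  match s with
  | (inl b, inl a) => w (inr c0, inr e0) *
      (w (inr c0, inl a) * w (inl b, inr e0) + w s)
  | (inr c, inr e) => w (inr c0, inr e0) *
      (if (c == c0) && (e == e0) then 1
       else w (inr c, inl a0) * w (inl b0, inr e) + w s * w (inl b0, inl a0))
  | _ => w (inr c0, inr e0) * w s
  end.
Proof.
rewrite /slot_lin; case: s => [[b|c] [a|e]] /=.
- by rewrite -/(xm _ _ _ _ _) x_cpsi !mxE !eqxx mul1r.
- by rewrite -/(xq _ _ _) x_cpsi !mxE.
- by rewrite -/(xp _ _ _) x_cpsi !mxE.
case: ifP => E /=; first by rewrite -/(x0 _) x_cpsi mulr1.
by rewrite -/(xm _ _ _ _ _) x_cpsi !mxE E.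
Qed.

Section Prefix.
Variables (U : seq slot) (s : slot).
Hypotheses (sU : s \notin U).
Hypothesis leU : forall s', s' \in U -> (slot_weight s' <= slot_weight s)%N.
Hypothesis ltU : forall s', (slot_weight s' < slot_weight s)%N -> s' \in U.

Let weight_d : slot_weight (inr c0, inr e0) = 0%N.
Proof. by rewrite /= !eqxx. Qed.
Let weight_B : slot_weight (inl b0, inl a0) = 1%N.
Proof. by rewrite /= !eqxx. Qed.

(** The entries of p and q are freed last, so the products p * q occurring in the coordinates of B
    and T still vanish. *)
Lemma slot_lin_prefix w : (forall s', s' \notin U -> w s' = 0) ->
  slot_lin s (slot_point w) = 0.
Proof.
move=> hw; rewrite slot_lin_point.
have hi s' : (slot_weight s < slot_weight s')%N -> w s' = 0.
  by move=> lt; apply: hw; apply: contraTN lt => /leU; rewrite -leqNgt.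
have ws := hw _ sU.
case: s sU hi ws => [[b|c] [a|e]] sU' hi ws; rewrite ?ws ?mulr0 //.
  by rewrite (hi (inr c0, inl a)) ?mul0r ?addr0 ?mulr0 //=; case: ifP.
case: ifP => E.
  by case/andP: E ws => /eqP -> /eqP -> ->; rewrite mul0r.
by rewrite (hi (inr c, inl a0)) ?mul0r ?addr0 ?mulr0 //= E.
Qed.

(** The factors d and B b0 a0 that may multiply the new parameter have been freed before it and are
    1 here. *)
Lemma slot_lin_next :
  slot_lin s (slot_point (fun s' => (s' \in s :: U)%:R)) = 1.
Proof.
rewrite slot_lin_point.
have hi s' : (slot_weight s < slot_weight s')%N -> (s' \in s :: U) = false.
  move=> lt; apply/negP; rewrite inE => /orP [/eqP e|/leU].
    by rewrite e ltnn in lt.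
  by rewrite leqNgt lt.
have lo s' : (slot_weight s' < slot_weight s)%N -> (s' \in s :: U).
  by move=> /ltU; rewrite inE orbC => ->.
have ss : s \in s :: U by rewrite inE eqxx.
have hd : (inr c0, inr e0) \in s :: U.
  case: (posnP (slot_weight s)) => [|h]; last by apply: lo; rewrite weight_d.
  case: s ss => [[b|c] [a|e]] //= ss'; first by case: ifP.
  by case: ifP ss' => // /andP [/eqP -> /eqP ->].
rewrite hd ss; case: s hi lo => [[b|c] [a|e]] hi lo.
- by rewrite (hi (inr c0, inl a)) /= ?mul0r ?add0r ?mulr1 //; case: ifP.
- by rewrite mulr1.
- by rewrite mulr1.
case: ifP => E; first by rewrite mulr1.
rewrite (hi (inr c, inl a0)) ?mul0r ?add0r ?mul1r /= ?E // lo //.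
by rewrite weight_B /= E.
Qed.

End Prefix.

Lemma chart_has_chain : has_chain X ((t + n') * (t + m')).
Proof.
rewrite -card_slot; pose r := sort (relpre slot_weight leq) (enum slot).
have sr : size r = #|slot| by rewrite size_sort cardE.
have ur : uniq r by rewrite sort_uniq enum_uniq.
have mr s : s \in r by rewrite mem_sort mem_enum.
have tot : total (relpre slot_weight leq) by move=> ? ?; apply: leq_total.
have tra : transitive (relpre slot_weight leq) by move=> ? ? ?; apply: leq_trans.
have srt : sorted (relpre slot_weight leq) r by apply: sort_sorted.
pose G k (x : Pt) := exists2 w, (forall s, s \notin take k r -> w s = 0) & x = slot_point w.
exists (fun k => zclosure (G k)); split=> [k _|k kD].
  split; first exact: zclosed_zclosure.
    apply: zirreducible_curves.
      by exists (slot_point (fun=> 0)); exists (fun=> 0).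
    move=> _ _ [w1 h1 ->] [w2 h2 ->].
    (* The parameters range over a linear subspace, so segments in it give the required curves. *)
    exists (fun a => slot_point (fun s => (1 - a) * w1 s + a * w2 s)).
    have pw s : upoly (fun a => (1 - a) * w1 s + a * w2 s).
      have hU := upoly_subalg K; apply: (fs_add hU); apply: (fs_mul hU);
        try exact: (fs_cst hU); last exact: upolyX.
      by apply: (fs_sub hU); [exact: (fs_cst hU) | exact: upolyX].
    split.
    - apply: (fs_cpsi (upoly_subalg K)) => // i j;
        try by apply: (fs_ext (upoly_subalg K)) (pw _) => a; rewrite mxE.
      apply: (fs_ext (upoly_subalg K) (f := fun a => if (i == c0) && (j == e0) then 1
        else (1 - a) * w1 (inr i, inr j) + a * w2 (inr i, inr j))) => [a|]; first by rewrite mxE.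
      by case: ((i == c0) && _); [exact: (fs_cst (upoly_subalg K)) | exact: pw].
    - by congr slot_point; apply: functional_extensionality => s; rewrite subr0 mul0r mul1r addr0.
    - by congr slot_point; apply: functional_extensionality => s; rewrite subrr mul0r mul1r add0r.
    move=> a; exists (fun s => (1 - a) * w1 s + a * w2 s) => // s ns.
    by rewrite h1 // h2 // !mulr0 addr0.
  move=> x; apply: (zclosure_min (zclosed_zclosure _)) => _ [w _ ->].
  exact: cpsi_Xt.
rewrite -sr in kD; set s := nth (inr c0, inr e0) r k.
have tS : take k.+1 r = rcons (take k r) s by rewrite (take_nth (inr c0, inr e0)).
have idx s' : (s' \in take k r) = (index s' r < k)%N by rewrite in_take.
have sU : s \notin take k r by rewrite idx index_uniq ?ltnn.
have nthw i j : (i <= j < size r)%N ->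
   (slot_weight (nth (inr c0, inr e0) r i) <= slot_weight (nth (inr c0, inr e0) r j))%N.
  move=> /andP [ij jr].
  apply: (sorted_leq_nth tra _ _ srt) => //; first by move=> ?; apply: leqnn.
  by rewrite inE (leq_ltn_trans ij).
have leU s' : s' \in take k r -> (slot_weight s' <= slot_weight s)%N.
  rewrite idx => ik; rewrite -(nth_index (inr c0, inr e0) (mr s')).
  by apply: nthw; rewrite ltnW.
have ltU s' : (slot_weight s' < slot_weight s)%N -> s' \in take k r.
  apply: contraTT; rewrite idx -!leqNgt => ki.
  rewrite -(nth_index (inr c0, inr e0) (mr s')); apply: nthw.
  by rewrite ki index_mem mr.
split.
  move=> x; apply: (zclosure_min (zclosed_zclosure _)) => _ [w hw ->].
  apply: sub_zclosure; exists w => // s' ns'; apply: hw.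
  by apply: contra ns'; rewrite tS mem_rcons inE orbC => ->.
pose w1 (s' : slot) : K := (s' \in s :: take k r)%:R.
exists (slot_point w1); split.
  apply: sub_zclosure; exists w1 => // s'.
  by rewrite tS mem_rcons /w1 => /negPf ->.
have [f hf] := polyfun_lin (slot_index s).1 (slot_index s).2.
have fG : vanishes (G k) f.
  by move=> _ [w hw ->]; rewrite hf; apply: (slot_lin_prefix sU leU).
move=> /(_ f fG); rewrite hf => /eqP.
have := slot_lin_next leU ltU.
by rewrite /slot_lin => ->; rewrite oner_eq0.
Qed.

End SmoothPoints.

End Charts.

(** * Singular points *)

Lemma inc_fun_inj t k (i : 'I_(ext_dim t k)) : injective (inc_fun i).
Proof.
move=> a b e; have /forallP h := valP (@enum_val _ {: Inc t k} i).
apply/val_inj; case: (ltngtP (val a) (val b)) => // lt.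
  by have /forallP/(_ b)/implyP/(_ lt) := h a; rewrite -/(inc_fun i) e ltnn.
by have /forallP/(_ a)/implyP/(_ lt) := h b; rewrite -/(inc_fun i) e ltnn.
Qed.

(** Listing the image of [al] before its complement gives the inverse permutation. *)
Lemma perm_lshift t k (al : 'I_t -> 'I_(t + k)) : (0 < t)%N -> injective al ->
  exists rho : {perm 'I_(t + k)}, forall a, (rho^-1)%g (lshift k a) = al a.
Proof.
move=> t_gt0 inj; pose s := map al (enum 'I_t) ++ [seq j <- enum 'I_(t + k) | j \notin codom al].
have us : uniq s.
  rewrite cat_uniq (map_inj_uniq inj) enum_uniq filter_uniq ?enum_uniq // andbT.
  by apply/hasPn => j; rewrite mem_filter => /andP [+ _]; rewrite codomE.
have ms : s =i enum 'I_(t + k).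
  move=> j; rewrite mem_cat mem_filter mem_enum /= andbT codomE.
  exact: orbN.
have size_s : size s = (t + k)%N.
  by rewrite (perm_size (uniq_perm us (enum_uniq _) ms)) size_enum_ord.
pose f (i : 'I_(t + k)) := nth (al (Ordinal t_gt0)) s i.
have f_inj : injective f.
  move=> i j /eqP; rewrite nth_uniq ?size_s ?ltn_ord // => /eqP; exact: val_inj.
exists (perm f_inj)^-1%g => a; rewrite invgK permE /f nth_cat size_map size_enum_ord /=.
by rewrite ltn_ord (nth_map a) ?size_enum_ord ?ltn_ord // nth_ord_enum.
Qed.

Lemma rank_le1P (F : fieldType) k l (x : 'M[F]_(k, l)) : (\rank x <= 1)%N ->
  exists g h, forall i j, x i j = g i * h j.
Proof.
move=> rx; exists (fun i => \sum_(u < \rank x) col_base x i u).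
exists (fun j => \sum_(u < \rank x) row_base x u j) => i j.
rewrite -{1}(mulmx_base x) mxE; case: (\rank x) (col_base x) (row_base x) rx => [|[|//]] C R _.
  by rewrite !big_ord0 mul0r.
by rewrite !big_ord1.
Qed.

Lemma polyfun_wedge (K : closedFieldType) m n t i j :
  polyfun (fun phi : 'M[K]_(n, m) => wedge_mx t phi i j).
Proof.
have hS := polyfun_subalg K n m.
apply: (fs_ext hS (f := fun phi => psi 1 0 0 phi 1%:M i j)) => [phi|]; first by rewrite wedge_psi.
by apply: (fs_psi hS) => *; try exact: (fs_cst hS); exact: polyfun_coord.
Qed.

Lemma has_chainS (K : closedFieldType) p q (X : 'M[K]_(p, q) -> Prop) d d' :
  (d <= d')%N -> has_chain X d' -> has_chain X d.
Proof.
move=> dd [Z [h1 h2]]; exists Z; split=> i id.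
  by apply: h1; apply: leq_trans dd.
by apply: h2; apply: leq_trans dd.
Qed.

Lemma is_dim_inj (K : closedFieldType) p q (X : 'M[K]_(p, q) -> Prop) d d' :
  is_dim X d -> is_dim X d' -> d = d'.
Proof.
move=> [h1 n1] [h2 n2]; case: (ltngtP d d') => // lt.
  by case: n1; apply: has_chainS h2.
by case: n2; apply: has_chainS h1.
Qed.

Theorem theorem6p8 (K : closedFieldType) (charK0 : [pchar K] =i pred0)
  (m n t : nat) (t_gt1 : (1 < t)%N) (t_lt : (t < minn m n)%N)
  (t_ne : m = n -> t <> m.-1)
  (x : 'M[K]_(ext_dim t n, ext_dim t m)) :
  singular_locus (@Xt K m n t) x <-> (@Xt K m n t x /\ (\rank x <= 1)%N).
Proof.
have [n' en] : exists n', n = (t + n')%N by exists (n - t)%N; lia.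
have [m' em] : exists m', m = (t + m')%N by exists (m - t)%N; lia.
subst n m; have t_gt0 : (0 < t)%N by lia.
have n'_gt0 : (0 < n')%N by lia.
have m'_gt0 : (0 < m')%N by lia.
(* If n' = m' = 1, then m = n = t + 1, the excluded case. *)
have nm_gt1 : (1 < n' * m')%N.
  have [e1|n1] := eqVneq n' 1%N; last by nia.
  have [e2|m1] := eqVneq m' 1%N; last by nia.
  by case: t_ne; lia.
pose a0 := Ordinal t_gt0; pose c0 := Ordinal n'_gt0; pose e0 := Ordinal m'_gt0.
have dimX : is_dim (@Xt K (t + m') (t + n') t) ((t + n') * (t + m')).
  split; first exact: (@chart_has_chain _ _ _ _ 1%g 1%g t_gt0 c0 e0 a0 a0).
  exact: (no_chain (@polyfun_wedge K (t + m') (t + n') t)).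
have chart : Xt x -> x != 0 -> exists (rho : {perm 'I_(t + n')}) (rho' : {perm 'I_(t + m')}),
    x0 rho rho' x != 0.
  move=> Xx /eqP x_neq0; have [i [j xij]] : exists i j, x i j != 0.
    apply: NNPP => h; apply: x_neq0; apply/matrixP => i j; rewrite mxE; apply/eqP.
    by apply: contraT => xij; case: h; exists i, j.
  have [rho hr] := perm_lshift t_gt0 (@inc_fun_inj _ _ i).
  have [rho' hr'] := perm_lshift t_gt0 (@inc_fun_inj _ _ j).
  exists rho, rho'; rewrite /x0 (lin_Xt _ _ Xx (i := i) (j := j)) //.
split=> [[Xx sing]|[Xx rx]]; split=> //.
  rewrite leqNgt; apply/negP => rx; apply: sing.
  have [|rho [rho' x00]] := chart Xx.
    by apply: contraTneq rx => ->; rewrite mxrank0.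
  (* Either some product is nonzero and x is smooth, or all vanish and x has rank at most 1. *)
  have [[c [a [e [b hM]]]]|hM] := classic (exists c a e b, xM rho rho' c a e b x != 0).
    exists ((t + n') * (t + m'))%N; split=> //.
    have ub := smooth_tangents t_gt0 Xx x00 hM.
    have [k [fs [fX lb]]] := smooth_equations t_gt0 x00 hM.
    rewrite card_slot in ub lb; split.
      by exists k, fs; split=> //; have := ub _ _ fX; lia.
    by move=> k' fs' fX'; have := ub _ _ fX'; lia.
  (* With B = 1 and T = 0 the coordinates are minors of P *m Q, which factor because P has t columns
     and Q has t rows. *)
  have := @degenerate_chart _ _ _ _ _ _ t_gt0 x 1%:M Xx x00.
  set d := x0 _ _ x; set p := _ *: _; set q := _ *: hatq _ _ x.
  move=> ex; suff : (\rank x <= 1)%N by rewrite leqNgt rx.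
  have -> : x = (\col_i (d * \det (rowsub (inc_fun i) (fullP rho 1 p)))) *m
                (\row_j \det (colsub (inc_fun j) (fullQ rho' 1 q))).
    rewrite [LHS]ex => [|c a e b]; last first.
      by apply/eqP; apply: contraT => h; case: hM; exists c, a, e, b.
    apply/matrixP => i j; rewrite !mxE big_ord1 !mxE bdet_schur ?unitmx1 //.
    rewrite det1 mul1r -mulrA -det_mulmx invmx1 mulmx1; congr (_ * \det _).
    apply/matrixP => u v; rewrite mxE [RHS]mxE.
    have -> : fullT rho rho' 0 = 0 :> 'M[K]_(t + n', t + m').
      by rewrite -(scale0r (0 : 'M[K]_(n', m'))) -scale_fullT scale0r.
    by rewrite add0r mxE; apply: eq_bigr => w _; rewrite !mxE.
  exact: mulmx_max_rank.
(* Nonsingularity prescribes a Jacobian rank of codimension n m, whereas the tangent vectors at x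
   number more than n m. *)
move=> [d [dX [[k [fs [fX rk]]] _]]]; rewrite (is_dim_inj dX dimX) in rk.
have slots := card_rank1_slot t_gt1 nm_gt1.
suff ub : (\rank (jacobian fs x) + #|rank1_slot t n' m'| <=
           ext_dim t (t + n') * ext_dim t (t + m'))%N by lia.
have [x_eq0|xn0] := eqVneq x 0.
  by rewrite x_eq0; apply: (zero_jacobian 1%g 1%g t_gt0).
have [rho [rho' x00]] := chart Xx xn0.
apply: (rank1_jacobian t_gt0 x00 _ fX) => B; apply: degenerate_chart => // c a e b.
(* At rank at most 1 the signed coordinates are products of a row and a column factor, so every [xM]
   vanishes. *)
have [g [h gh]] := rank_le1P rx; have [G [H GH]] := lin_rank1 gh.
by rewrite /xM /x0 /xp /xq /xm !GH; ring.
Qed.
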